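(* Let $\mathbb{X}=\mathbb{R}^{n_x}$, $\mathbb{U}=\mathbb{R}^{n_u}$, $T>0$ an integer, $\eta>-1$, $\eta\ne0$. Consider the linear Gaussian system $p(x_{t+1}\mid x_t,u_t)=\mathcal{N}(A_tx_t+B_tu_t,\Sigma_t)$, $t\in\{0,\dots,T-1\}$, with quadratic costs $c_t(x,u)=(x^\top Q_tx+u^\top R_tu)/2$ and $c_T(x)=x^\top Q_Tx/2$, where $\Sigma_t$, $Q_t$, $R_t$ are positive definite for all $t$. Assume there exists a solution $\{\Pi_t\}_{t=0}^T$ of the Riccati difference equation $$\Pi_t=Q_t+A_t^\top\Pi_{t+1}\big(I-\eta\Sigma_t\Pi_{t+1}+B_tR_t^{-1}B_t^\top\Pi_{t+1}\big)^{-1}A_t,\ \ t\in\{0,\dots,T-1\},\qquad \Pi_T=Q_T,$$ such that $\Sigma_t^{-1}-\eta\Pi_{t+1}$ is positive definite for every $t\in\{0,\dots,T-1\}$. Then the unique optimal policy of the problem $$\underset{\{\pi_t\}_{t=0}^{T-1}}{\mathrm{minimize}}\ \frac{1}{\eta}\log\mathbb{E}\Big[\exp\Big(\eta c_T(x_T)+\eta\sum_{t=0}^{T-1}\big(c_t(x_t,u_t)+\log\pi_t(u_t\mid x_t)\big)\Big)\Big]$$ (with $u_t\sim\pi_t(\cdot\mid x_t)$, each $\pi_t(\cdot\mid x)$ a probability density on $\mathbb{U}$) is $$\pi_t^*(u\mid x)=\mathcal{N}\Big(u\,\Big|\,-\big(R_t+B_t^\top\Pi_{t+1}(I-\eta\Sigma_t\Pi_{t+1})^{-1}B_t\big)^{-1}B_t^\top\Pi_{t+1}(I-\eta\Sigma_t\Pi_{t+1})^{-1}A_tx,\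 \big(R_t+B_t^\top\Pi_{t+1}(I-\eta\Sigma_t\Pi_{t+1})^{-1}B_t\big)^{-1}\Big).$$
   Context: $\mathcal{N}(\cdot\mid\mu,\Sigma)$ denotes the Gaussian density with mean $\mu$ and covariance $\Sigma$; $I$ is the identity matrix of appropriate dimension. The initial state $x_0$ has an arbitrary given distribution.
   Formalization: Uniqueness is claimed only when the optimal value is finite (for η>0 and heavy-tailed x_0 every policy has value +∞, so all are optimal) and up to null sets: π_0 for almost every x under the law of x_0 and a.e. u, π_t for t≥1 Lebesgue-a.e. in (x,u); policies are jointly measurable. *)

(* Defs.v *)
From HB Require Import structures.
From mathcomp Require Import all_boot all_order all_algebra.
From mathcomp Require Import all_classical all_reals all_analysis.
Set Implicit Arguments. Unset Strict Implicit. Unset Printing Implicit Defensive.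
Import Order.TTheory GRing.Theory Num.Theory.
Import numFieldNormedType.Exports.
Local Open Scope classical_set_scope.
Local Open Scope ring_scope.

Definition Rvec (R : realType) (n : nat) :=
  g_sigma_algebraType (@open 'cV[R]_n).

(* Lebesgue integral over R^n of a function with values in \bar R,
   computed as the iterated one-dimensional Lebesgue integral
   (for nonnegative measurable functions this is the Lebesgue integral on
   R^n by Tonelli). *)
Fixpoint lint (R : realType) (n : nat) : ('cV[R]_n -> \bar R) -> \bar R :=
  match n return ('cV[R]_n -> \bar R) -> \bar R with
  | 0 => fun f => f 0
  | m.+1 => fun f =>
      (\int[@lebesgue_measure R]_(r in setT)
          lint (fun v : 'cV[R]_m => f (col_mx (r%:M) v)))%E
  end.

Definition posdef (R : realType) (n : nat) (M : 'M[R]_n) : Prop :=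
  M^T = M /\ forall x : 'cV[R]_n, x != 0 -> 0 < (x^T *m M *m x) 0 0.

Definition gauss_pdf (R : realType) (n : nat) (m : 'cV[R]_n) (S : 'M[R]_n)
    (x : 'cV[R]_n) : R :=
  (Num.sqrt ((pi *+ 2) ^+ n * \det S))^-1 *
  expR (- ((x - m)^T *m invmx S *m (x - m)) 0 0 / 2).

Definition qf (R : realType) (n : nat) (M : 'M[R]_n) (x : 'cV[R]_n) : R :=
  ((x^T *m M *m x) 0 0) / 2.

Definition admissible (R : realType) (nx nu T : nat)
    (pol : nat -> 'cV[R]_nx -> 'cV[R]_nu -> R) : Prop :=
  forall t, (t < T)%N ->
    [/\ forall x u, 0 <= pol t x u,
        forall x, lint (fun u => (pol t x u)%:E) = 1%E &
        measurable_fun setT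
          (fun z : Rvec R (nx + nu) => pol t (usubmx z) (dsubmx z))].

(* One backward step: given the "exponentiated cost-to-go" V at time t+1,
   V_t(x) = E_{u ~ pi_t(.|x)} [ exp(eta (c_t(x,u) + log pi_t(u|x)))
              * E_{x' ~ N(A_t x + B_t u, Sigma_t)} V(x') ]. *)
Definition rs_step (R : realType) (nx nu : nat) (eta : R)
    (A : nat -> 'M[R]_nx) (B : nat -> 'M[R]_(nx, nu)) (Sig : nat -> 'M[R]_nx)
    (Q : nat -> 'M[R]_nx) (Rc : nat -> 'M[R]_nu)
    (pol : nat -> 'cV[R]_nx -> 'cV[R]_nu -> R) (t : nat)
    (V : 'cV[R]_nx -> \bar R) (x : 'cV[R]_nx) : \bar R :=
  lint (fun u : 'cV[R]_nu =>
    ((pol t x u)%:E *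
     (expR (eta * (qf (Q t) x + qf (Rc t) u + ln (pol t x u))))%:E *
     lint (fun x' : 'cV[R]_nx =>
        (gauss_pdf (A t *m x + B t *m u) (Sig t) x')%:E * V x'))%E).

(* rs_value k = V_{T-k}, with V_T(x) = exp(eta c_T(x)). *)
Fixpoint rs_value (R : realType) (nx nu : nat) (T : nat) (eta : R)
    (A : nat -> 'M[R]_nx) (B : nat -> 'M[R]_(nx, nu)) (Sig : nat -> 'M[R]_nx)
    (Q : nat -> 'M[R]_nx) (Rc : nat -> 'M[R]_nu)
    (pol : nat -> 'cV[R]_nx -> 'cV[R]_nu -> R) (k : nat) :
    'cV[R]_nx -> \bar R :=
  match k with
  | 0 => fun x => (expR (eta * qf (Q T) x))%:E
  | k'.+1 => rs_step eta A B Sig Q Rc pol (T - k'.+1)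
               (rs_value T eta A B Sig Q Rc pol k')
  end.

(* The objective (1/eta) log E[ exp( eta c_T(x_T)
      + eta sum_t (c_t(x_t,u_t) + log pi_t(u_t|x_t)) ) ],
   x_0 ~ mu0, u_t ~ pi_t(.|x_t), x_{t+1} ~ N(A_t x_t + B_t u_t, Sigma_t),
   with values in the extended reals. *)
Definition rs_objective (R : realType) (nx nu : nat) (T : nat) (eta : R)
    (A : nat -> 'M[R]_nx) (B : nat -> 'M[R]_(nx, nu)) (Sig : nat -> 'M[R]_nx)
    (Q : nat -> 'M[R]_nx) (Rc : nat -> 'M[R]_nu)
    (mu0 : probability (Rvec R nx) R)
    (pol : nat -> 'cV[R]_nx -> 'cV[R]_nu -> R) : \bar R :=
  ((eta^-1)%:E * lne (\int[mu0]_(x in setT)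
                        rs_value T eta A B Sig Q Rc pol T x))%E.

(* Main.v *)
(* The value functions of the candidate policy stay in the family
   V_t(x) = exp(eta (x^T Pi_t x / 2 + k_t)): integrating a Gaussian against
   V_{t+1} and completing squares gives exp(eta c_t) E[V_{t+1}] =
   V_t(x) pi*_t(u|x)^(-eta), where the Riccati equation enters through Woodbury's
   identity.  One Bellman step for a policy p then amounts to comparing the
   integral of p^(1+eta) q^(-eta), q = pi*_t, with 1; it is compared pointwise
   with (1+eta) p - eta q, which integrates to 1, by convexity of exp, with
   equality iff p = q.  The comparison goes up for eta > 0 and down for
   -1 < eta < 0, i.e. always against p in the objective.  Backward induction gives
   optimality.  If the objectives coincide and are finite, equality holds in every
   step almost everywhere, and is propagated forward in time: since the policy and
   transition densities are positive, equality of V_t at one point forces equality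
   of V_{t+1} almost everywhere. *)

Require Import Defs.
From HB Require Import structures.
From mathcomp Require Import all_boot all_order all_algebra.
From mathcomp Require Import all_classical all_reals all_analysis.
From mathcomp Require Import measurable_realfun ring lra.
Set Implicit Arguments. Unset Strict Implicit. Unset Printing Implicit Defensive.
Import Order.TTheory GRing.Theory Num.Theory.
Import numFieldNormedType.Exports.
Local Open Scope classical_set_scope.
Local Open Scope ring_scope.

(** * Borel measurability on R^n *)

Section borel_vectors.
Context {R : realType}.

Lemma measurable_coord (n : nat) (i : 'I_n) :
  measurable_fun setT (fun v : Rvec R n => v i 0 : R).
Proof.
apply: (measurability _ (RGenOInfty.measurableE R)).
move=> /= _ [_ [a ->]] <-; rewrite setTI; apply: sub_sigma_algebra.
apply: open_comp; last exact: interval_open.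
by move=> x _; exact: coord_continuous.
Qed.

(* An open subset of R^n is the union of the rational boxes it contains. *)
Lemma measurable_fun_vec {d : measure_display} {Z : measurableType d} {n : nat}
    (f : Z -> Rvec R n) :
  (forall i, measurable_fun setT (fun z => f z i 0 : R)) ->
  measurable_fun setT f.
Proof.
move=> mf; apply: (@measurability _ _ _ _ setT f (@open (matrix R n 1))) => //.
move=> /= _ [U oU <-]; rewrite setTI.
pose box (k : 'cV[rat]_n * rat) : set 'cV[R]_n :=
  [set v | forall i, `|v i 0 - ratr (k.1 i 0)| < ratr k.2].
(* Boxes not contained in [U] contribute the empty set, so that the union runs over the whole
   countable type of rational boxes. *)
pose F (k : 'cV[rat]_n * rat) : set Z :=
  if pselect (box k `<=` U) then f @^-1` box k else set0.
have -> : f @^-1` U = \bigcup_k F k.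
  apply/seteqP; split => [z /= Ufz|z [k _]]; last first.
    by rewrite /F; case: pselect => //= kU /kU.
  move: oU; rewrite openE => /(_ _ Ufz) /nbhs_ballP[e /= e0 eU].
  (* Half of [e] suffices: a point of the box is within [r] of the centre, which is itself within
     [r] of [f z]. *)
  have [r /itvP rP] : exists r : rat, ratr r \in `]0, (e / 2)[.
    by apply: rat_in_itvoo; lra.
  have r0 : 0 < ratr r :> R by rewrite rP.
  have qP i : exists q : rat, `|f z i 0 - ratr q| < ratr r.
    have [|q] := @rat_in_itvoo R (f z i 0 - ratr r) (f z i 0 + ratr r).
      lra.
    rewrite in_itv /= => /andP[q1 q2]; exists q; rewrite ltr_norml.
    by apply/andP; split; lra.
  have [q qE] := choice qP.
  exists (\col_i q i, r) => //; rewrite /F; case: pselect => [_|] /=.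
    by move=> i; rewrite mxE.
  case=> v bv; apply: eU; split=> // i j; rewrite ord1.
  have := bv i; rewrite mxE /= => vq.
  rewrite /ball /=.
  rewrite (_ : _ - _ = (f z i 0 - ratr (q i)) + (ratr (q i) - v i 0)); last by ring.
  rewrite (le_lt_trans (ler_normD _ _))// [`|ratr _ - _|]distrC.
  have := qE i; have : ratr r < e / 2 by rewrite rP.
  move: vq; lra.
apply: countable_bigcupT_measurable; first exact: countableP.
move=> k; rewrite /F; case: pselect => //= _.
have -> : f @^-1` box k =
    \bigcap_(i in [set: 'I_n]) [set z | `|f z i 0 - ratr (k.1 i 0)| < ratr k.2].
  by apply/seteqP; split => z /= h i; [move=> _|]; exact: h.
apply: fin_bigcap_measurable; first exact: finite_finset.
move=> i _; rewrite -[X in measurable X]setTI.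
have mfi : measurable_fun setT (fun z => `|f z i 0 - ratr (k.1 i 0)| : R).
  by apply: measurableT_comp => //; apply: measurable_funB => //; exact: mf.
have mc : measurable_fun setT (fun _ : Z => ratr k.2 : R) by [].
exact: (measurable_fun_ltr mfi mc measurableT (I : measurable [set true])).
Qed.

(** * Entrywise measurability of matrix-valued maps *)

Section mx.
Context {d : measure_display} {Z : measurableType d}.

(** The entrywise form reduces matrix algebra to sums and products of real functions; on column
    vectors it agrees with Borel measurability by [mxmeas_vec]. *)
Definition mxmeas (m n : nat) (f : Z -> 'M[R]_(m, n)) :=
  forall i j, measurable_fun setT (fun z => f z i j).

Lemma mxmeas_cst m n (M : 'M[R]_(m, n)) : mxmeas (fun=> M).
Proof. by move=> i j; exact: measurable_cst. Qed.

Lemma mxmeasD m n (f g : Z -> 'M[R]_(m, n)) :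
  mxmeas f -> mxmeas g -> mxmeas (fun z => f z + g z).
Proof.
move=> mf mg i j; rewrite (_ : (fun _ => _) = (fun z => f z i j + g z i j)).
  exact: measurable_funD.
by apply/funext => z; rewrite mxE.
Qed.

Lemma mxmeasN m n (f : Z -> 'M[R]_(m, n)) :
  mxmeas f -> mxmeas (fun z => - f z).
Proof.
move=> mf i j; rewrite (_ : (fun _ => _) = (fun z => - f z i j)).
  exact: measurable_funN.
by apply/funext => z; rewrite mxE.
Qed.

Lemma mxmeas_tr m n (f : Z -> 'M[R]_(m, n)) :
  mxmeas f -> mxmeas (fun z => (f z)^T).
Proof.
move=> mf i j; rewrite (_ : (fun _ => _) = (fun z => f z j i)); first exact: mf.
by apply/funext => z; rewrite mxE.
Qed.

Lemma mxmeasM m n p (f : Z -> 'M[R]_(m, n)) (g : Z -> 'M[R]_(n, p)) :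
  mxmeas f -> mxmeas g -> mxmeas (fun z => f z *m g z).
Proof.
move=> mf mg i j; rewrite (_ : (fun _ => _) = (fun z => \sum_k f z i k * g z k j)).
  by apply: measurable_sum => k; exact: measurable_funM.
by apply/funext => z; rewrite mxE.
Qed.

Lemma mxmeas_col m1 m2 n (f : Z -> 'M[R]_(m1, n)) (g : Z -> 'M[R]_(m2, n)) :
  mxmeas f -> mxmeas g -> mxmeas (fun z => col_mx (f z) (g z)).
Proof.
move=> mf mg i j; case: (split_ordP i) => k ->.
- rewrite (_ : (fun _ => _) = (fun z => f z k j)); first exact: mf.
  by apply/funext => z; rewrite col_mxEu.
- rewrite (_ : (fun _ => _) = (fun z => g z k j)); first exact: mg.
  by apply/funext => z; rewrite col_mxEd.
Qed.

Lemma mxmeas_usub m1 m2 n (f : Z -> 'M[R]_(m1 + m2, n)) :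
  mxmeas f -> mxmeas (fun z => usubmx (f z)).
Proof.
by move=> mf i j; under eq_fun do rewrite mxE; exact: mf.
Qed.

Lemma mxmeas_dsub m1 m2 n (f : Z -> 'M[R]_(m1 + m2, n)) :
  mxmeas f -> mxmeas (fun z => dsubmx (f z)).
Proof.
by move=> mf i j; under eq_fun do rewrite mxE; exact: mf.
Qed.

Lemma mxmeas_vec n (f : Z -> Rvec R n) :
  measurable_fun setT f <-> mxmeas (f : Z -> 'cV[R]_n).
Proof.
split=> mf; last by apply: measurable_fun_vec => i; exact: mf.
move=> i j; rewrite ord1.
exact: (measurableT_comp (measurable_coord i)).
Qed.

Lemma mxmeas_scalar (f : Z -> R) :
  measurable_fun setT f -> mxmeas (fun z => ((f z)%:M : 'M[R]_1)).
Proof.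
move=> mf i j; rewrite (_ : (fun _ => _) = f) //.
by apply/funext => z; rewrite !ord1 mxE eqxx.
Qed.

End mx.

Context {d : measure_display} {Z : measurableType d}.

Lemma measurable_qf n (M : 'M[R]_n) (f : Z -> 'cV[R]_n) :
  mxmeas f -> measurable_fun setT (fun z => qf M (f z)).
Proof.
move=> mf; apply: measurable_funM => //.
by apply: mxmeasM => //; apply: mxmeasM; [exact: mxmeas_tr|exact: mxmeas_cst].
Qed.

Lemma measurable_gauss_pdf n (S : 'M[R]_n) (f g : Z -> 'cV[R]_n) :
  mxmeas f -> mxmeas g ->
  measurable_fun setT (fun z => gauss_pdf (f z) S (g z)).
Proof.
move=> mf mg; apply: measurable_funM => //; apply: measurableT_comp => //.
rewrite (_ : (fun _ => _) = (fun z => - qf (invmx S) (g z - f z))).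
  apply: measurable_funN; apply: measurable_qf; apply: mxmeasD => //.
  exact: mxmeasN.
by apply/funext => z; rewrite /qf mulNr.
Qed.

End borel_vectors.

(** * Iterated Lebesgue integration *)

Section lint_theory.
Context {R : realType}.
Local Open Scope ereal_scope.

Local Notation leb := (@lebesgue_measure R).

(** Phrased through [Rvec], which carries the Borel structure, because [lint] takes functions on
    plain column vectors. *)
Definition vmeas (n : nat) (f : 'cV[R]_n -> \bar R) :=
  measurable_fun setT (f : Rvec R n -> \bar R).

Lemma measurable_cons {d : measure_display} {Z : measurableType d} (n : nat)
    (f : Z -> measurableTypeR R) (g : Z -> Rvec R n) :
  measurable_fun setT f -> measurable_fun setT g ->
  measurable_fun setT (fun z => col_mx (f z)%:M (g z) : Rvec R n.+1).
Proof.
move=> mf mg; apply/mxmeas_vec; apply: (@mxmeas_col _ _ _ 1 n 1); last exact/mxmeas_vec.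
exact: mxmeas_scalar.
Qed.

Lemma lint_ge0 (n : nat) (f : 'cV[R]_n -> \bar R) :
  (forall v, 0 <= f v) -> 0 <= lint f.
Proof.
elim: n f => [|n IH] f f0 /=; first exact: f0.
by apply: integral_ge0 => r _; exact: IH.
Qed.

Lemma eq_lint (n : nat) (f g : 'cV[R]_n -> \bar R) : f =1 g -> lint f = lint g.
Proof. by move=> fg; congr lint; apply/funext. Qed.

(** The parameter space [Z] is arbitrary so that the induction can enlarge it by the first
    coordinate; what remains is Tonelli measurability of a one-dimensional integral. *)
Lemma measurable_lint (n : nat) {d : measure_display} {Z : measurableType d}
    (f : Z * Rvec R n -> \bar R) :
  measurable_fun setT f -> (forall z, 0 <= f z) ->
  measurable_fun setT (fun z => lint (fun v => f (z, v))).
Proof.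
elim: n d Z f => [|n IH] d Z f mf f0 /=;
  first exact: (measurable_fun_pair1 ((0%R : 'cV[R]_0) : Rvec R 0) mf).
pose g (w : (Z * measurableTypeR R) * Rvec R n) :=
  f (w.1.1, col_mx (w.1.2)%:M w.2 : Rvec R n.+1).
have mg : measurable_fun setT g.
  apply: measurableT_comp => //; apply: measurable_fun_pair.
    exact: measurableT_comp.
  by apply: measurable_cons => //; exact: measurableT_comp.
have mG := IH _ _ g mg (fun w => f0 _).
exact: (@measurable_fun_fubini_tonelli_F _ _ _ _ _ leb _ mG
  (fun w => lint_ge0 (fun v => f0 _))).
Qed.

Lemma vmeas_section (n : nat) (f : 'cV[R]_n.+1 -> \bar R) (r : R) :
  vmeas f -> vmeas (fun v => f (col_mx r%:M v)).
Proof.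
move=> mf; apply: (measurableT_comp mf).
by apply: measurable_cons.
Qed.

Lemma measurable_lint_section (n : nat) (f : 'cV[R]_n.+1 -> \bar R) :
  vmeas f -> (forall v, 0 <= f v) ->
  measurable_fun setT (fun r : measurableTypeR R =>
    lint (fun v : 'cV[R]_n => f (col_mx r%:M v))).
Proof.
move=> mf f0; apply: (@measurable_lint n _ _
  (fun w : measurableTypeR R * Rvec R n => f (col_mx w.1%:M w.2))) => //.
by apply: (measurableT_comp mf); exact: measurable_cons.
Qed.

Lemma lintD (n : nat) (f g : 'cV[R]_n -> \bar R) :
  vmeas f -> vmeas g -> (forall v, 0 <= f v) -> (forall v, 0 <= g v) ->
  lint (fun v => f v + g v) = lint f + lint g.
Proof.
elim: n f g => [//|n IH] f g mf mg f0 g0 /=.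
rewrite -ge0_integralD//=; last 4 first.
- by move=> r _; exact: lint_ge0.
- exact: measurable_lint_section.
- by move=> r _; exact: lint_ge0.
- exact: measurable_lint_section.
by apply: eq_integral => r _; rewrite IH//; exact: vmeas_section.
Qed.

Lemma lintZ (n : nat) (k : R) (f : 'cV[R]_n -> \bar R) :
  (0 <= k)%R -> vmeas f -> (forall v, 0 <= f v) ->
  lint (fun v => k%:E * f v) = k%:E * lint f.
Proof.
move=> k0; elim: n f => [//|n IH] f mf f0 /=.
rewrite -ge0_integralZl_EFin//=; last 2 first.
- by move=> r _; exact: lint_ge0.
- exact: measurable_lint_section.
by apply: eq_integral => r _; rewrite IH//; exact: vmeas_section.
Qed.

Lemma le_lint (n : nat) (f g : 'cV[R]_n -> \bar R) :
  vmeas f -> vmeas g -> (forall v, 0 <= f v) -> (forall v, f v <= g v) ->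
  lint f <= lint g.
Proof.
elim: n f g => [|n IH] f g mf mg f0 fg /=; first exact: fg.
have g0 v : 0 <= g v by exact: le_trans (fg v).
apply: ge0_le_integral => //=.
- by move=> r _; exact: lint_ge0.
- exact: measurable_lint_section.
- exact: measurable_lint_section.
by move=> r _; apply: IH => //; exact: vmeas_section.
Qed.

(** The iterated integral already places the first [m] coordinates outermost, so this is
    associativity of [col_mx]. *)
Lemma lint_add (m n : nat) (f : 'cV[R]_(m + n) -> \bar R) :
  lint f = lint (fun x => lint (fun u => f (col_mx x u))).
Proof.
elim: m f => [|m IH] f /=.
  apply: eq_lint => u; congr f; apply/matrixP => i j; rewrite (ord1 j).
  case: (split_ordP (i : 'I_(0 + n))) => k ->; first by case: k.
  by rewrite col_mxEd; congr (u _ _); apply/val_inj.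
apply: eq_integral => r _; rewrite (IH (fun v => f (col_mx r%:M v))).
apply: eq_lint => x; apply: eq_lint => u; congr f.
exact: etrans (@col_mxA _ 1 m n 1 r%:M x u) (castmx_id _ _).
Qed.

(** * Almost-everywhere statements matching the iterated integral *)

Definition aeleb (P : R -> Prop) : Prop :=
  almost_everywhere (leb : {measure set (measurableTypeR R) -> \bar R}) P.

Lemma aelebS (P Q : R -> Prop) : (forall r, P r -> Q r) -> aeleb P -> aeleb Q.
Proof. by move=> PQ; exact: (@filterS _ _ (ae_filter_ringOfSetsType leb)). Qed.

Lemma aelebI (P Q : R -> Prop) :
  aeleb P -> aeleb Q -> aeleb (fun r => P r /\ Q r).
Proof. exact: (@filterI _ _ (ae_filter_ringOfSetsType leb)). Qed.

Lemma aeleb_ex (P : R -> Prop) : aeleb P -> exists r, P r.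
Proof.
have leb0 : 0 < leb setT by rewrite -set_itvNyy lebesgue_measure_itv/= ltry.
have PF := ae_properfilter_algebraOfSetsType leb0.
by move=> aP; have [r Pr] := @filter_ex _ _ PF P aP; exists r.
Qed.

(* Iterated "almost everywhere", following the recursion of [lint]; by Tonelli it
   is Lebesgue-a.e. on R^n for measurable properties. *)
Fixpoint lae (n : nat) : ('cV[R]_n -> Prop) -> Prop :=
  match n return ('cV[R]_n -> Prop) -> Prop with
  | 0 => fun P => P 0%R
  | m.+1 => fun P =>
      aeleb (fun r => lae (fun v : 'cV[R]_m => P (col_mx (r%:M) v)))
  end.

Lemma laeW (n : nat) (P Q : 'cV[R]_n -> Prop) :
  (forall v, P v -> Q v) -> lae P -> lae Q.
Proof.
elim: n P Q => [|n IH] P Q PQ; first exact: PQ.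
by apply: aelebS => r; apply: IH => v; exact: PQ.
Qed.

Lemma laeI (n : nat) (P Q : 'cV[R]_n -> Prop) :
  lae P -> lae Q -> lae (fun v => P v /\ Q v).
Proof.
elim: n P Q => [|n IH] P Q; first by split.
move=> aP aQ; apply: aelebS (aelebI aP aQ) => r [/= ? ?]; exact: IH.
Qed.

(** Supplies the single points at which equalities known almost everywhere are exploited to move one
    stage further. *)
Lemma lae_ex (n : nat) (P : 'cV[R]_n -> Prop) : lae P -> exists v, P v.
Proof.
elim: n P => [|n IH] P; first by exists 0%R.
by move=> /aeleb_ex[r /IH[v Pv]]; exists (col_mx r%:M v).
Qed.

(* If [f <= g] have the same finite integral then [g - f] integrates to [0]. *)
Lemma integral_eq_ae {d : measure_display} {X : measurableType d}
    (mu : {measure set X -> \bar R}) (f g : X -> \bar R) :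
  measurable_fun setT f -> measurable_fun setT g ->
  (forall x, 0 <= f x) -> (forall x, f x <= g x) ->
  \int[mu]_x f x = \int[mu]_x g x -> \int[mu]_x f x < +oo ->
  \forall x \ae mu, f x = g x /\ f x < +oo.
Proof.
move=> mf mg f0 fg fgE foo.
have g0 x : 0 <= g x by exact: le_trans (fg x).
have If : mu.-integrable setT f.
  by apply/integrableP; split=> //; under eq_integral do rewrite gee0_abs//.
have Ig : mu.-integrable setT g.
  apply/integrableP; split=> //; under eq_integral do rewrite gee0_abs//.
  by rewrite -fgE.
have ffin := integrable_ae measurableT If.
have gfin := integrable_ae measurableT Ig.
have : ae_eq mu setT (f \- g) (cst 0).
  apply/ae_eq_integral_abs => //; first exact: emeasurable_funB.
  (* The absolute value of [f - g] is [g - f] only where the values are finite, hence the detour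
     through equality almost everywhere. *)
  rewrite (ae_eq_integral (g \- f)) //=; last 3 first.
  - by apply: measurableT_comp => //; exact: emeasurable_funB.
  - exact: emeasurable_funB.
  - move: ffin gfin; apply: filterS2 => x /(_ I) fx /(_ I) gx _ /=.
    by rewrite -abseN fin_num_oppeB// addeC gee0_abs// sube_ge0// fx.
  by rewrite integralB//= fgE subee// -fgE ge0_fin_numE// integral_ge0.
move: ffin gfin; apply: filterS3 => x /(_ I) fx /(_ I) gx /(_ I) /= /eqP.
by rewrite sube_eq// add0e => /eqP fgx; split=> //; rewrite -ge0_fin_numE.
Qed.

(** [integral_eq_ae] on the outer integral makes almost all inner integrals equal and finite, which
    is exactly what the induction hypothesis asks for. *)
Lemma lint_eq_lae (n : nat) (f g : 'cV[R]_n -> \bar R) :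
  vmeas f -> vmeas g -> (forall v, 0 <= f v) -> (forall v, f v <= g v) ->
  lint f = lint g -> lint f < +oo -> lae (fun v => f v = g v).
Proof.
elim: n f g => [//|n IH] f g mf mg f0 fg fgE foo.
have g0 v : 0 <= g v by exact: le_trans (fg v).
have := @integral_eq_ae _ _ leb _ _ (measurable_lint_section mf f0)
  (measurable_lint_section mg g0) _ _ fgE foo.
have hf0 r : 0 <= lint (fun v : 'cV[R]_n => f (col_mx r%:M v)) by exact: lint_ge0.
have hfg (r : R) : lint (fun v : 'cV[R]_n => f (col_mx r%:M v)) <=
    lint (fun v => g (col_mx r%:M v)).
  by apply: le_lint => //; exact: vmeas_section.
move=> /(_ hf0 hfg); apply: aelebS => r [h1 h2].
by apply: IH => //; exact: vmeas_section.
Qed.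

Lemma lint_lae0 (n : nat) (f : 'cV[R]_n -> \bar R) :
  vmeas f -> (forall v, 0 <= f v) -> lae (fun v => f v = 0) -> lint f = 0.
Proof.
elim: n f => [//|n IH] f mf f0 fE; rewrite [LHS]/=.
transitivity (\int[leb]_(r in setT) (cst 0 r : \bar R)); last exact: integral0.
apply: ge0_ae_eq_integral => //=.
- exact: measurable_lint_section.
- by move=> r _; exact: lint_ge0.
move: fE; apply: aelebS => r fE _; apply: IH => //; exact: vmeas_section.
Qed.

End lint_theory.

(** * Positive definite matrices and Gaussian integrals *)

Section posdef_theory.
Context {R : realType}.

Lemma qfE (n : nat) (M : 'M[R]_n) x : (x^T *m M *m x) 0 0 = qf M x *+ 2.
Proof. by rewrite /qf -[RHS]mulr_natr divfK// pnatr_eq0. Qed.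

Lemma posdef_qf (n : nat) (M : 'M[R]_n) x : posdef M -> x != 0 -> 0 < qf M x.
Proof. by move=> [_ pM] x0; rewrite divr_gt0//; exact: pM. Qed.

Lemma qf0 (n : nat) (M : 'M[R]_n) : qf M 0 = 0.
Proof. by rewrite /qf mulmx0 mxE mul0r. Qed.

Lemma posdef_qf_ge0 (n : nat) (M : 'M[R]_n) x : posdef M -> 0 <= qf M x.
Proof.
move=> pM; have [->|x0] := eqVneq x 0; first by rewrite qf0.
exact: ltW (posdef_qf pM x0).
Qed.

Lemma qf_posdef (n : nat) (M : 'M[R]_n) :
  M^T = M -> (forall x, x != 0 -> 0 < qf M x) -> posdef M.
Proof. by move=> sM pM; split=> // x /pM h; rewrite qfE pmulrn_lgt0. Qed.

Lemma qf_comp (m n : nat) (M : 'M[R]_m) (A : 'M[R]_(m, n)) x :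
  qf M (A *m x) = qf (A^T *m M *m A) x.
Proof. by rewrite /qf trmx_mul !mulmxA. Qed.

Lemma qfDl (n : nat) (M N : 'M[R]_n) x : qf (M + N) x = qf M x + qf N x.
Proof. by rewrite /qf mulmxDr mulmxDl mxE mulrDl. Qed.

Lemma qfZl (n : nat) k (M : 'M[R]_n) x : qf (k *: M) x = k * qf M x.
Proof. by rewrite /qf -scalemxAr -scalemxAl mxE mulrA. Qed.

Lemma qfN (n : nat) (M : 'M[R]_n) x : qf M (- x) = qf M x.
Proof. by rewrite /qf [_^T]linearN !(mulNmx, mulmxN) opprK. Qed.

Lemma qfD (n : nat) (M : 'M[R]_n) x y : M^T = M ->
  qf M (x + y) = qf M x + (x^T *m M *m y) 0 0 + qf M y.
Proof.
move=> sM; rewrite /qf [_^T]linearD !(mulmxDl, mulmxDr).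
have -> : y^T *m M *m x = (x^T *m M *m y)^T by rewrite !trmx_mul trmxK sM mulmxA.
rewrite (_ : forall P : 'M[R]_1, P^T = P); first by rewrite !mxE; field.
by move=> P; apply/matrixP => i j; rewrite !ord1 mxE.
Qed.

Lemma posdefD (n : nat) (M N : 'M[R]_n) : posdef M -> posdef N -> posdef (M + N).
Proof.
move=> pM pN; apply: qf_posdef; first by rewrite linearD /= pM.1 pN.1.
by move=> x x0; rewrite qfDl addr_gt0// posdef_qf.
Qed.

Lemma posdefZ (n : nat) k (M : 'M[R]_n) : 0 < k -> posdef M -> posdef (k *: M).
Proof.
move=> k0 pM; apply: qf_posdef; first by rewrite linearZ /= pM.1.
by move=> x x0; rewrite qfZl mulr_gt0// posdef_qf.
Qed.

Lemma posdef_unit (n : nat) (M : 'M[R]_n) : posdef M -> M \in unitmx.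
Proof.
move=> pM; rewrite -row_free_unit -kermx_eq0; apply/eqP/row_matrixP => i.
rewrite row0; apply: contraTeq isT => u0.
have : (row i (kermx M))^T != 0.
  by apply: contraNneq u0 => /(congr1 trmx); rewrite trmxK trmx0 => ->.
move=> /(pM.2 _); rewrite trmxK -row_mul mulmx_ker row0 mul0mx mxE.
by rewrite ltxx.
Qed.

Lemma posdef_inv (n : nat) (M : 'M[R]_n) : posdef M -> posdef (invmx M).
Proof.
move=> pM; have uM := posdef_unit pM.
have sV : (invmx M)^T = invmx M by rewrite trmx_inv pM.1.
apply: qf_posdef => // x x0.
have -> : qf (invmx M) x = qf M (invmx M *m x).
  by rewrite qf_comp sV mulVmx// mul1mx.
apply: posdef_qf => //; apply: contraNneq x0 => /(congr1 (mulmx M)).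
by rewrite mulmxA mulmxV// mul1mx mulmx0 => ->.
Qed.

(* [s] is the Schur complement of the lower right block [D]. *)
Lemma posdef_schur (n : nat) (P : 'M[R]_(1 + n)) : posdef P ->
  exists (s : R) (g : 'cV[R]_n) (D : 'M[R]_n),
    [/\ 0 < s, posdef D, \det P = s * \det D &
      forall (r : R) (v : 'cV[R]_n),
        qf P (col_mx r%:M v) = s * r ^+ 2 / 2 + qf D (v + r *: g)].
Proof.
move=> pP; pose D := drsubmx P; pose w := dlsubmx P.
have sD : D^T = D by rewrite /D trmx_drsub pP.1.
have urE : ursubmx P = w^T by rewrite /w trmx_dlsub pP.1.
pose a := P 0 0.
have ulE : ulsubmx P = a%:M.
  apply/matrixP => i j; rewrite !ord1 !mxE eqxx mulr1n.
  by rewrite (_ : lshift n 0 = 0)//; apply/val_inj.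
have PE : P = block_mx a%:M w^T w D by rewrite -ulE -urE submxK.
have qfP (r : R) (v : 'cV[R]_n) : qf P (col_mx r%:M v) =
    a * r ^+ 2 / 2 + r * (w^T *m v) 0 0 + qf D v.
  rewrite {1}PE /qf tr_col_mx mul_row_block mul_row_col.
  rewrite tr_scalar_mx !mulmxDl !mul_scalar_mx !mul_mx_scalar -scalemxAl.
  have -> : v^T *m w = (w^T *m v)^T by rewrite trmx_mul trmxK.
  move: (w^T *m v) (v^T *m D *m v) => y z.
  by rewrite !mxE eqxx mulr1n; field.
have pD : posdef D.
  apply: qf_posdef => // v v0; have := qfP 0 v.
  rewrite expr2 !mul0r !mulr0 mul0r !add0r => <-; apply: posdef_qf => //.
  by apply: contraNneq v0 => /(congr1 dsubmx); rewrite col_mxKd => ->; rewrite linear0.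
have uD := posdef_unit pD.
(* Completing the square in [v]: for given [r] the minimiser is [- r g], and [s] is the coefficient
   left over. *)
pose g := invmx D *m w; pose s := a - (w^T *m g) 0 0.
have qfS (r : R) (v : 'cV[R]_n) : qf P (col_mx r%:M v) =
    s * r ^+ 2 / 2 + qf D (v + r *: g).
  rewrite qfP qfD// /s.
  have -> : v^T *m D *m (r *: g) = r *: (w^T *m v)^T.
    by rewrite -scalemxAr /g mulmxA mulmxK// trmx_mul trmxK.
  have -> : qf D (r *: g) = r ^+ 2 * (w^T *m g) 0 0 / 2.
    rewrite /qf [_^T]linearZ /= -!scalemxAl -scalemxAr scalerA -expr2.
    have -> : g^T *m D *m g = (w^T *m g)^T.
      by rewrite -mulmxA (_ : D *m g = w) ?trmx_mul ?trmxK// /g mulKVmx.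
    by move: (w^T *m g) => y; rewrite !mxE.
  move: (w^T *m v) (w^T *m g) (qf D v) => y z q.
  by rewrite !mxE; field.
have s0 : 0 < s.
  (* At the vector with blocks [1] and [- g] the term in [D] vanishes and only [s / 2] remains. *)
  have := qfS 1 (- g); rewrite scale1r addNr qf0 addr0 expr1n mulr1 => sE.
  have : 0 < s / 2; last by lra.
  rewrite -sE; apply: posdef_qf => //.
  apply/eqP => /(congr1 usubmx); rewrite col_mxKu linear0.
  by move=> /matrixP /(_ 0 0) /eqP; rewrite !mxE eqxx mulr1n oner_eq0.
exists s, g, D; split=> //.
(* A column operation of determinant 1 makes [P] block triangular, which gives the determinant. *)
have : P *m block_mx 1%:M 0 (- g) 1%:M = block_mx s%:M w^T 0 D.
  rewrite PE mulmx_block !mulmx1 !mulmx0 !add0r; congr block_mx.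
    rewrite mulmxN /s; move: (w^T *m g) => y.
    by apply/matrixP => i j; rewrite !ord1 !mxE eqxx !mulr1n.
  by rewrite mulmxN /g mulmxA mulmxV// mul1mx subrr.
move=> /(congr1 determinant).
by rewrite det_mulmx det_lblock !det1 !mulr1 det_ublock det_scalar1.
Qed.

End posdef_theory.

(** * Gaussian integrals *)

Section gaussian_integral.
Context {R : realType}.

(** The integrand is the normal density of mean [c] and variance [1 / s] without its normalising
    factor. *)
Lemma integral_gauss1 (s c : R) : 0 < s ->
  (\int[@lebesgue_measure R]_(r in setT) (expR (- (s * (r - c) ^+ 2 / 2)))%:E =
   (Num.sqrt (pi *+ 2 / s))%:E)%E.
Proof.
move=> s0; pose sg := (Num.sqrt s)^-1.
have sg0 : sg != 0 by rewrite invr_eq0 gt_eqF// sqrtr_gt0.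
have sg2 : sg ^+ 2 = s^-1 by rewrite exprVn sqr_sqrtr// ltW.
have := integral_normal_pdf c sg; rewrite normal_pdfE//.
under eq_integral do rewrite EFinM.
rewrite ge0_integralZl_EFin//; last 3 first.
- by move=> r _; rewrite lee_fin normal_fun_ge0.
- by apply/measurable_EFinP; exact: measurable_normal_fun.
- exact: normal_peak_ge0.
have -> : normal_peak sg = (Num.sqrt (pi *+ 2 / s))^-1.
  by rewrite /normal_peak sg2 -mulrnAr mulrC.
have k0 : 0 < Num.sqrt (pi *+ 2 / s).
  by rewrite sqrtr_gt0 divr_gt0// pmulrn_lgt0// pi_gt0.
rewrite (eq_integral (fun r : measurableTypeR R =>
  (expR (- (s * (r - c) ^+ 2 / 2)))%:E)); last first.
  move=> r _; congr (expR _)%:E; rewrite sg2; field.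
  by rewrite gt_eqF.
move: (integral _ _ _) => X h; rewrite -[LHS]mul1e -(mulfV (lt0r_neq0 k0)).
rewrite EFinM -muleA.
exact: etrans (congr1 (mule _) h) (mule1 _).
Qed.

Lemma col_mx_scalarB (n : nat) (r s : R) (v w : 'cV[R]_n) :
  col_mx r%:M v - col_mx s%:M w = col_mx (r - s)%:M (v - w) :> 'cV_(1 + n).
Proof. by rewrite opp_col_mx add_col_mx raddfB. Qed.

(** Induction through [posdef_schur]: for each first coordinate the inner integral is a Gaussian in
    [D] whose centre moves but whose value does not, and the outer one has precision [s]. The centre
    [c] is quantified inside the induction for this reason. *)
Lemma lint_gauss (n : nat) (P : 'M[R]_n) : posdef P -> 0 < \det P /\
  forall c : 'cV[R]_n, lint (fun v => (expR (- qf P (v - c)))%:E) =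
    (Num.sqrt ((pi *+ 2) ^+ n / \det P))%:E.
Proof.
elim: n P => [|n IH] P pP.
  rewrite det_mx00; split=> // c /=.
  by rewrite [0 - c]flatmx0 qf0 oppr0 expR0 divr1 sqrtr1.
have [s [g [D [s0 pD detP qfP]]]] := @posdef_schur R n P pP.
have [detD0 IHD] := IH _ pD.
have det0 : 0 < \det P by rewrite detP mulr_gt0.
split=> // c; rewrite [LHS]/=.
pose c0 := usubmx (c : 'cV_(1 + n)) 0 0; pose c1 := dsubmx (c : 'cV_(1 + n)).
have cE : c = col_mx c0%:M c1.
  have -> : c0%:M = usubmx (c : 'cV_(1 + n)).
    by apply/matrixP => i j; rewrite !ord1 /c0; move: (usubmx _) => y; rewrite mxE.
  exact/esym/(@vsubmxK _ 1 n 1).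
set k := Num.sqrt ((pi *+ 2) ^+ n / \det D) in IHD.
transitivity (\int[@lebesgue_measure R]_(r in setT)
    (k%:E * (expR (- (s * (r - c0) ^+ 2 / 2)))%:E))%E.
  apply: eq_integral => r _.
  rewrite -(IHD (c1 - (r - c0) *: g)) muleC -lintZ ?expR_ge0//; last first.
    apply/measurable_EFinP; apply: measurableT_comp => //.
    apply: measurable_funN; apply: measurable_qf.
    by apply: mxmeasD; [exact/mxmeas_vec|exact: mxmeas_cst].
  apply: eq_lint => v; rewrite -EFinM -expRD; congr (expR _)%:E.
  have -> : col_mx r%:M v - c = col_mx (r - c0)%:M (v - c1).
    by rewrite {1}cE; exact: col_mx_scalarB.
  by rewrite qfP opprD; congr (_ - qf _ _); rewrite opprB addrCA addrC.
rewrite ge0_integralZl_EFin//; last 2 first.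
- apply/measurable_EFinP; apply: measurableT_comp => //.
  apply: measurable_funN; apply: measurable_funM => //; apply: measurable_funM => //.
  by apply: measurable_funX; exact: measurable_funB.
- exact: sqrtr_ge0.
rewrite integral_gauss1// -EFinM -sqrtrM; last first.
  apply: divr_ge0; last exact: ltW.
  by apply: exprn_ge0; apply: mulrn_wge0; exact: pi_ge0.
rewrite detP; congr (Num.sqrt _)%:E; rewrite exprS; field.
by rewrite !gt_eqF.
Qed.

Lemma lint_gauss_pdf (n : nat) (S : 'M[R]_n) (m : 'cV[R]_n) : posdef S ->
  lint (fun x => (gauss_pdf m S x)%:E) = 1%E.
Proof.
move=> pS; have [detV lintE] := lint_gauss (posdef_inv pS).
have k0 : 0 < Num.sqrt ((pi *+ 2 : R) ^+ n * \det S).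
  rewrite sqrtr_gt0 mulr_gt0//.
    by apply: exprn_gt0; rewrite pmulrn_lgt0// pi_gt0.
  by rewrite -invr_gt0 -det_inv.
under eq_lint do rewrite /gauss_pdf mulNr EFinM.
rewrite lintZ; last 3 first.
- by rewrite invr_ge0 ltW.
- apply/measurable_EFinP; apply: measurableT_comp => //.
  apply: measurable_funN; apply: measurable_qf.
  by apply: mxmeasD; [exact/mxmeas_vec|exact: mxmeas_cst].
- by move=> v; rewrite lee_fin expR_ge0.
by rewrite [lint _]lintE det_inv invrK -EFinM mulVf// gt_eqF.
Qed.

Lemma gauss_pdf_gt0 (n : nat) (S : 'M[R]_n) (m x : 'cV[R]_n) : posdef S ->
  0 < gauss_pdf m S x.
Proof.
move=> pS; have [detV _] := lint_gauss (posdef_inv pS).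
rewrite mulr_gt0 ?expR_gt0// invr_gt0 sqrtr_gt0 mulr_gt0//.
  by rewrite exprn_gt0// pmulrn_lgt0// pi_gt0.
by rewrite -invr_gt0 -det_inv.
Qed.

End gaussian_integral.

(** * The Riccati step *)

Lemma trmx_congr {R : realType} (m n : nat) (W : 'M[R]_m) (C : 'M[R]_(m, n)) :
  W^T = W -> (C^T *m W *m C)^T = C^T *m W *m C.
Proof. by move=> sW; rewrite !trmx_mul trmxK sW mulmxA. Qed.

Section lq_step.
Context {R : realType} {nx nu : nat}.
Variables (eta : R) (A : 'M[R]_nx) (B : 'M[R]_(nx, nu)) (Sig Q : 'M[R]_nx).
Variables (Rc : 'M[R]_nu) (Pi0 Pi1 : 'M[R]_nx).
Hypothesis (eta0 : eta != 0).
Hypothesis (pSig : posdef Sig) (pQ : posdef Q) (pRc : posdef Rc).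
Hypothesis (pPi1 : posdef Pi1).

(** [P] is the precision of the transition density tilted by the exponentiated cost-to-go, [W] the
    resulting weight on the mean of the next state, [M] the precision of the optimal policy, and [Y]
    the matrix inverted in the Riccati equation. *)
Let X := 1%:M - eta *: (Sig *m Pi1).
Let W := Pi1 *m invmx X.
Let M := Rc + B^T *m W *m B.
Let P := invmx Sig - eta *: Pi1.
Let Y := X + B *m invmx Rc *m B^T *m Pi1.

Hypothesis (pP : posdef P).
Hypothesis (uY : Y \in unitmx).
Hypothesis Pi0E : Pi0 = Q + A^T *m Pi1 *m invmx Y *m A.

Let XE : X = Sig *m P.
Proof. by rewrite /P mulmxBr mulmxV ?posdef_unit// -scalemxAr. Qed.

Let uX : X \in unitmx.
Proof. by rewrite XE unitmx_mul !posdef_unit. Qed.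

Let WE : W = Pi1 *m invmx P *m invmx Sig.
Proof.
rewrite /W -mulmxA; congr mulmx; apply: (can_inj (mulKmx uX)).
by rewrite mulmxV// XE !mulmxA mulmxK ?posdef_unit// mulmxV ?posdef_unit.
Qed.

(** This form shows symmetry, and positivity when [eta] is nonnegative. *)
Let WE2 : W = Pi1 + eta *: (Pi1 *m invmx P *m Pi1).
Proof.
rewrite WE; have -> : invmx Sig = P + eta *: Pi1 by rewrite subrK.
by rewrite mulmxDr mulmxKV ?posdef_unit// -scalemxAr.
Qed.

(** This is the form in which [W] comes out of completing the square in the Gaussian exponent. *)
Let WE3 : eta *: W = invmx Sig *m invmx P *m invmx Sig - invmx Sig.
Proof.
rewrite WE !scalemxAl.
have -> : eta *: Pi1 = invmx Sig - P by rewrite /P opprB addrC subrK.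
by rewrite mulmxBl mulmxV ?posdef_unit// mulmxBl mul1mx.
Qed.

(** For [eta >= 0], [WE2] is a positive definite matrix plus a nonnegative one. For [eta < 0], [W]
    is the inverse of [Pi1^-1 - eta Sig], a sum of positive definite matrices. *)
Lemma posdef_W : posdef W.
Proof.
have [eta_ge0|eta_lt0] := leP 0 eta.
  apply: qf_posdef => [|x x0].
    rewrite WE2 linearD linearZ /= !trmx_mul trmx_inv pP.1 pPi1.1.
    by rewrite mulmxA.
  rewrite WE2 qfDl qfZl -[X in X *m invmx P](pPi1.1) -qf_comp.
  rewrite ltr_pwDl ?posdef_qf// mulr_ge0// posdef_qf_ge0//.
  exact: posdef_inv.
have pZ : posdef (invmx Pi1 + (- eta) *: Sig).
  apply: posdefD; first exact: posdef_inv.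
  by apply: posdefZ => //; rewrite oppr_gt0.
suff -> : W = invmx (invmx Pi1 + (- eta) *: Sig) by exact: posdef_inv.
apply: (can_inj (mulmxK (posdef_unit pZ))).
rewrite mulVmx ?posdef_unit// WE mulmxDr -scalemxAr mulmxKV ?posdef_unit//.
have -> : Pi1 *m invmx P *m invmx Sig *m invmx Pi1 =
    Pi1 *m invmx P *m (P + eta *: Pi1) *m invmx Pi1 by rewrite subrK.
rewrite mulmxDr mulmxKV ?posdef_unit// -scalemxAr mulmxDl mulmxV ?posdef_unit//.
by rewrite -scalemxAl mulmxK ?posdef_unit// scaleNr addrK.
Qed.

Lemma posdef_M : posdef M.
Proof.
apply: qf_posdef => [|u u0].
  by rewrite [_^T]linearD /= pRc.1 trmx_congr// posdef_W.1.
rewrite qfDl -qf_comp ltr_pwDl ?posdef_qf ?posdef_qf_ge0//.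
exact: posdef_W.
Qed.

Let uM := posdef_unit posdef_M.

(* Woodbury's identity, multiplied by [Y] on the right. *)
Lemma riccati_woodbury :
  Pi1 *m invmx Y = W - W *m B *m invmx M *m B^T *m W.
Proof.
apply: (can_inj (mulmxK uY)); rewrite mulmxKV//.
have WX : W *m X = Pi1 by rewrite mulmxKV.
(* Since [W X = Pi1], [Y] factors as [(1 + K) X] with [K = B Rc^-1 B^T W], and [X] cancels from the
   identity. *)
have -> : Y = X + B *m invmx Rc *m B^T *m W *m X.
  by rewrite -(mulmxA _ W X) WX.
rewrite -{1}[X]mul1mx -mulmxDl mulmxA -[LHS]WX; congr (_ *m _).
rewrite mulmxDr mulmx1 mulmxBl.
set K := B *m invmx Rc *m B^T *m W.
suff -> : W *m K = W *m B *m invmx M *m B^T *m W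
    + W *m B *m invmx M *m B^T *m W *m K.
  by rewrite addrK subrK.
transitivity (W *m B *m invmx M *m (M *m invmx Rc *m B^T *m W)).
  by rewrite /K !mulmxA mulmxKV.
have -> : M *m invmx Rc *m B^T *m W = B^T *m W + B^T *m W *m K.
  by rewrite /K {1}/M mulmxDl mulmxV ?posdef_unit// !mulmxDl mul1mx !mulmxA.
by rewrite mulmxDr !mulmxA.
Qed.

(** Completing the square in [u] leaves a quadratic form in [x] whose matrix is a Schur complement;
    [riccati_woodbury] identifies it with [Pi0]. *)
Lemma cost_complete_square x u :
  qf Q x + qf Rc u + qf W (A *m x + B *m u) =
  qf M (u - - (invmx M *m B^T *m W *m A *m x)) + qf Pi0 x.
Proof.
have sW := posdef_W.1; have sM := posdef_M.1.
pose K := invmx M *m B^T *m W *m A.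
have MK : M *m K = B^T *m W *m A by rewrite /K !mulmxA mulmxV// mul1mx.
rewrite opprK -/K !qfD//.
have -> : qf M u = qf Rc u + qf W (B *m u) by rewrite qfDl -qf_comp.
have -> : u^T *m M *m (K *m x) = ((A *m x)^T *m W *m (B *m u))^T.
  rewrite (mulmxA (u^T *m M) K x) -(mulmxA u^T M K) MK; move: (W) sW => V sV.
  by rewrite !trmx_mul !trmxK sV !mulmxA.
have -> : qf Pi0 x = qf Q x + qf W (A *m x) - qf M (K *m x).
  have -> : Pi0 = Q + A^T *m W *m A + (-1) *: (K^T *m M *m K).
    rewrite Pi0E -addrA; congr (_ + _).
    rewrite -(mulmxA A^T) riccati_woodbury mulmxBr mulmxBl; congr (_ + _).
    rewrite scaleN1r -(mulmxA K^T M K) MK; congr (- _).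
    rewrite /K; move: (W) (M) sW sM => V N sV sN.
    by rewrite !trmx_mul trmxK trmx_inv sN sV !mulmxA.
  by rewrite 2!qfDl qfZl -(qf_comp W A) -(qf_comp M K) mulN1r.
move: ((A *m x)^T *m W *m (B *m u)) => z; rewrite [in RHS]mxE.
by ring.
Qed.

(** At the minimising [u] the completed square expresses [qf Pi0] as [qf Q] plus nonnegative terms,
    so positivity passes to the preceding time. *)
Lemma posdef_riccati : posdef Pi0.
Proof.
have sW := posdef_W.1; have sM := posdef_M.1.
apply: qf_posdef.
  rewrite Pi0E -(mulmxA A^T) riccati_woodbury [_^T]linearD /= pQ.1.
  congr (_ + _); apply: trmx_congr; rewrite [_^T]linearB /= sW; congr (_ - _).
  have -> : W *m B *m invmx M *m B^T *m W = (B^T *m W)^T *m invmx M *m (B^T *m W).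
    by rewrite [(_ *m W)^T]trmx_mul sW trmxK !mulmxA.
  by rewrite trmx_congr// trmx_inv sM.
move=> x x0.
have := cost_complete_square x (- (invmx M *m B^T *m W *m A *m x)).
rewrite subrr qf0 add0r => <-.
rewrite -addrA ltr_pwDl ?posdef_qf// addr_ge0// posdef_qf_ge0//.
exact: posdef_W.
Qed.

(** The tilted density has precision [P] and mean [P^-1 Sig^-1 m]; by [WE3] the remainder is
    governed by [W]. *)
Lemma gauss_complete_square (m x : 'cV[R]_nx) :
  - qf (invmx Sig) (x - m) + eta * qf Pi1 x =
  - qf P (x - invmx P *m invmx Sig *m m) + eta * qf W m.
Proof.
have sS := (posdef_inv pSig).1; have sP := pP.1.
pose c := invmx P *m invmx Sig *m m.
rewrite -!qfZl WE3 -/c !qfD// !qfN.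
have -> : qf P x = qf (invmx Sig) x - qf (eta *: Pi1) x.
  by rewrite /P qfDl -scaleNr !qfZl mulNr.
have -> : x^T *m P *m (- c) = x^T *m invmx Sig *m (- m).
  by rewrite /c !mulmxN !mulmxA mulmxK ?posdef_unit.
have -> : qf P c = qf (invmx Sig *m invmx P *m invmx Sig) m.
  rewrite /c -mulmxA !qf_comp; congr qf.
  by rewrite sS trmx_inv sP mulVmx ?posdef_unit// mul1mx.
rewrite qfDl -[- invmx Sig]scaleN1r !qfZl.
by ring.
Qed.

(** After [gauss_complete_square] the integrand is an unnormalised Gaussian times a factor free of
    [x]. The constant [k] is chosen first because it depends on neither [m] nor [c]. *)
Lemma lint_gauss_quadratic : exists2 k : R, 0 < k &
  forall (m : 'cV[R]_nx) (c : R),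
  (lint (fun x => (gauss_pdf m Sig x)%:E * (expR (eta * (qf Pi1 x + c)))%:E) =
   (k * expR (eta * (qf W m + c)))%:E)%E.
Proof.
have [detS _] := lint_gauss (posdef_inv pSig).
have [detP lintP] := lint_gauss pP.
pose a : R := (Num.sqrt ((pi *+ 2) ^+ nx * \det Sig))^-1.
pose b : R := Num.sqrt ((pi *+ 2) ^+ nx / \det P).
have pin0 : 0 < (pi *+ 2 : R) ^+ nx.
  by apply: exprn_gt0; rewrite pmulrn_lgt0// pi_gt0.
have a0 : 0 < a.
  by rewrite invr_gt0 sqrtr_gt0 mulr_gt0// -invr_gt0 -det_inv.
have b0 : 0 < b by rewrite sqrtr_gt0 divr_gt0.
exists (a * b); first exact: mulr_gt0.
move=> m c; pose d := invmx P *m invmx Sig *m m.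
pose e := a * expR (eta * (qf W m + c)).
transitivity (lint (fun x => e%:E * (expR (- qf P (x - d)))%:E))%E.
  apply: eq_lint => x; rewrite -!EFinM; congr EFin.
  rewrite /gauss_pdf -/a /e -!mulrA -!expRD mulNr; congr (_ * expR _).
  by rewrite !mulrDr addrA gauss_complete_square /d; ring.
rewrite lintZ.
- by rewrite lintP -EFinM /e; congr EFin; rewrite -/b; ring.
- by rewrite mulr_ge0 ?expR_ge0// ltW.
- apply/measurable_EFinP; apply: measurableT_comp => //.
  apply: measurable_funN; apply: measurable_qf.
  by apply: mxmeasD; [exact/mxmeas_vec|exact: mxmeas_cst].
- by move=> x; rewrite lee_fin expR_ge0.
Qed.

Let pstar x u := gauss_pdf (- (invmx M *m B^T *m W *m A *m x)) (invmx M) u.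

(* The cost-to-go weighted by the running cost is a power of the density
   [pstar], which reduces the choice of the policy to Young's inequality. *)
Lemma optimal_step c : exists c0 : R, exists2 G : 'cV[R]_nx -> 'cV[R]_nu -> R,
  (forall x u,
    (lint (fun x' => (gauss_pdf (A *m x + B *m u) Sig x')%:E *
       (expR (eta * (qf Pi1 x' + c)))%:E) = (G x u)%:E)%E) &
  (forall x u, expR (eta * (qf Q x + qf Rc u)) * G x u =
    expR (eta * (qf Pi0 x + c0)) * expR (- (eta * ln (pstar x u)))).
Proof.
have [k k0 kE] := lint_gauss_quadratic.
pose a : R := (Num.sqrt ((pi *+ 2) ^+ nu * \det (invmx M)))^-1.
have a0 : 0 < a.
  have := gauss_pdf_gt0 0 0 (posdef_inv posdef_M).
  by rewrite /gauss_pdf -/a pmulr_lgt0 ?expR_gt0.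
(* [ln k / eta] absorbs the constant of the Gaussian integral, and [ln a] offsets the normalising
   factor of [pstar]. *)
exists (ln k / eta + c + ln a).
exists (fun x u => k * expR (eta * (qf W (A *m x + B *m u) + c))).
  by move=> x u; rewrite kE.
move=> x u.
have -> : ln (pstar x u) =
    ln a - qf M (u - - (invmx M *m B^T *m W *m A *m x)).
  rewrite /pstar /gauss_pdf -/a invmxK mulNr lnM ?posrE ?expR_gt0//.
  by rewrite expRK.
rewrite -{1}(lnK k0) -!expRD; congr expR.
have := cost_complete_square x u.
move: (qf Q x) (qf Rc u) (qf W _) (qf M _) (qf Pi0 x) => q1 q2 q3 q4 q5 h.
have -> : q5 = q1 + q2 + q3 - q4 by rewrite h; ring.
by field.
Qed.

End lq_step.

(** * Young's inequality with its equality case *)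

Section risk_sensitive_young.
Context {R : realType}.
Implicit Types eta p q : R.

(** For [p > 0], dividing by [p] with [L = ln p - ln q] leaves
    [1 + eta <= exp (eta L) + eta exp (- L)]. The tangent lines of both exponentials at 0 add up to
    this, the second being strict unless [L = 0]. *)
Lemma young_pos eta p q : 0 < eta -> 0 <= p -> 0 < q ->
  (1 + eta) * p <= p * expR (eta * ln p) * expR (- (eta * ln q)) + eta * q
    ?= iff (p == q).
Proof.
move=> eta0; rewrite le_eqVlt => /orP[/eqP <-|p0] q0.
  (* At [p = 0] the factor [p] annihilates the default value of [ln 0], and the inequality is
     strict. *)
  rewrite mulr0 !mul0r add0r; apply/leifP; rewrite lt_eqF//.
  by rewrite mulr_gt0.
rewrite -mulrA -expRD -mulrN -mulrDr.
pose L := ln p - ln q.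
have -> : q = p * expR (- L).
  by rewrite /L opprB expRD expRN !lnK ?posrE// mulrC mulfVK// gt_eqF.
have -> : ln (p * expR (- L)) = ln p - L.
  by rewrite lnM ?posrE ?expR_gt0// expRK.
rewrite opprB addrCA subrr addr0 [eta * (p * _)]mulrCA -mulrDr mulrC.
rewrite -[X in X == _]mulr1 (inj_eq (mulfI (lt0r_neq0 p0))).
apply/leifP; have [h|h] := eqVneq 1 (expR (- L)).
  have L0 : L = 0 by rewrite -[L]opprK -[- L]expRK -h ln1 oppr0.
  by rewrite L0 oppr0 mulr0 expR0 mulr1.
have L0 : - L != 0 by apply: contra_neq h => ->; rewrite expR0.
rewrite ltr_pM2l//; clearbody L.
have h1 := expR_ge1Dx (eta * L).
have h2 : eta * (1 - L) < eta * expR (- L) by rewrite ltr_pM2l// expR_gt1Dx.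
move: h1 h2; rewrite mulrBr mulr1.
move: (expR (eta * L)) (eta * expR (- L)) (eta * L) => a b c h1 h2; lra.
Qed.

(** For [p > 0], with the same [L], division by [p] leaves [exp (eta L) <= (1 + eta) + (- eta) exp
    (- L)]: strict convexity with weights [1 + eta] and [- eta], both positive here. *)
Lemma young_neg eta p q : -1 < eta -> eta < 0 -> 0 <= p -> 0 < q ->
  p * expR (eta * ln p) * expR (- (eta * ln q)) <= (1 + eta) * p + - eta * q
    ?= iff (p == q).
Proof.
move=> eta1 eta0; rewrite le_eqVlt => /orP[/eqP <-|p0] q0.
  rewrite mulr0 !mul0r add0r; apply/leifP; rewrite lt_eqF//.
  by rewrite mulr_gt0// oppr_gt0.
rewrite -mulrA -expRD -mulrN -mulrDr.
pose L := ln p - ln q.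
have -> : q = p * expR (- L).
  by rewrite /L opprB expRD expRN !lnK ?posrE// mulrC mulfVK// gt_eqF.
have -> : ln (p * expR (- L)) = ln p - L.
  by rewrite lnM ?posrE ?expR_gt0// expRK.
rewrite opprB addrCA subrr addr0 [- eta * (p * _)]mulrCA [(1 + eta) * p]mulrC -mulrDr.
rewrite -[X in X == _]mulr1 (inj_eq (mulfI (lt0r_neq0 p0))).
apply/leifP; have [h|h] := eqVneq 1 (expR (- L)).
  have L0 : L = 0 by rewrite -[L]opprK -[- L]expRK -h ln1 oppr0.
  by rewrite L0 oppr0 mulr0 expR0; apply/eqP; ring.
have L0 : - L != 0 by apply: contra_neq h => ->; rewrite expR0.
rewrite ltr_pM2l//; clearbody L.
(* tangent line of [expR] at [eta * L], a convex combination of [0] and [- L] *)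
have e0 := expR_gt0 (eta * L).
have h1 : expR (eta * L) * (1 - eta * L) < 1.
  have eL0 : - (eta * L) != 0.
    by rewrite oppr_eq0 mulf_eq0 lt_eqF//= -oppr_eq0.
  by have := expR_gt1Dx eL0; rewrite -(ltr_pM2l e0) -expRD subrr expR0.
have h2 : expR (eta * L) * (1 - (1 + eta) * L) <= expR (- L).
  have := expR_ge1Dx (- ((1 + eta) * L)); rewrite -(ler_pM2l e0) -expRD.
  by rewrite (_ : eta * L - (1 + eta) * L = - L) //; ring.
have eta1' : 0 < 1 + eta by lra.
have eN : 0 < - eta by lra.
move: h1 h2; set E := expR (eta * L); set F := expR (- L) => h1 h2.
have -> : E = (1 + eta) * (E * (1 - eta * L)) + - eta * (E * (1 - (1 + eta) * L)).
  by ring.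
by rewrite ltr_leD ?ler_pM2l// -[ltRHS]mulr1 ltr_pM2l.
Qed.

End risk_sensitive_young.

(** * The order induced by the objective, and the integrated Young inequality *)

Section dom.
Context {R : realType} (eta : R).
Hypothesis eta0 : eta != 0.
Local Open Scope ereal_scope.

(* [a] is at least as good as [b] for the objective [eta^-1 * log _]. *)
Definition dom (a b : \bar R) :=
  ((0 < eta)%R -> a <= b) /\ ((eta < 0)%R -> b <= a).

Lemma dom_refl a : dom a a. Proof. by split=> _. Qed.

Lemma dom_trans a b c : dom a b -> dom b c -> dom a c.
Proof.
by move=> [h1 h2] [h3 h4]; split=> e; [apply: le_trans (h1 e) (h3 e)|
  apply: le_trans (h4 e) (h2 e)].
Qed.

Lemma dom_squeeze a b c : dom a b -> dom b c -> a = c -> b = a.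
Proof.
move=> [h1 h2] [h3 h4] ac; rewrite -ac in h3 h4.
have := eta0; rewrite neq_lt => /orP[e|e]; apply/le_anti.
- by rewrite h2// h4.
- by rewrite h1// h3.
Qed.

Lemma dom_mull k a b : 0 <= k -> dom a b -> dom (k * a) (k * b).
Proof. by move=> k0 [h1 h2]; split=> e; rewrite lee_wpmul2l// ?h1 ?h2. Qed.

Lemma dom_lint (n : nat) (f g : 'cV[R]_n -> \bar R) :
  vmeas f -> vmeas g -> (forall v, 0 <= f v) -> (forall v, 0 <= g v) ->
  (forall v, dom (f v) (g v)) -> dom (lint f) (lint g).
Proof.
move=> mf mg f0 g0 fg; split=> e; apply: le_lint => // v.
- exact: (fg v).1.
- exact: (fg v).2.
Qed.

Lemma dom_lint_eq (n : nat) (f g : 'cV[R]_n -> \bar R) :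
  vmeas f -> vmeas g -> (forall v, 0 <= f v) -> (forall v, 0 <= g v) ->
  (forall v, dom (f v) (g v)) -> lint f = lint g -> lint f < +oo ->
  lae (fun v => g v = f v).
Proof.
move=> mf mg f0 g0 fg fgE foo.
have := eta0; rewrite neq_lt => /orP[e|e].
  apply: lint_eq_lae => //; last by rewrite -fgE.
  by move=> v; exact: (fg v).2.
apply: laeW (lint_eq_lae mf mg f0 _ fgE foo) => // v.
exact: (fg v).1.
Qed.

Hypothesis eta1 : (-1 < eta)%R.

Lemma vmeas_young (n : nat) (p q : 'cV[R]_n -> R) :
  vmeas (EFin \o p) -> vmeas (EFin \o q) ->
  vmeas (fun v => (p v * expR (eta * ln (p v)) * expR (- (eta * ln (q v))))%:E).
Proof.
move=> /measurable_EFinP mp /measurable_EFinP mq.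
apply/measurable_EFinP; apply: measurable_funM; first apply: measurable_funM => //.
  apply: measurableT_comp => //; apply: measurable_funM => //.
  exact: measurableT_comp.
apply: measurableT_comp => //; apply: measurable_funN.
by apply: measurable_funM => //; exact: measurableT_comp.
Qed.

(** Both densities have mass 1, so the linear terms of Young's inequality integrate to known
    constants; equality of integrals then falls back on the pointwise equality case. *)
Lemma lint_young (n : nat) (p q : 'cV[R]_n -> R) :
  vmeas (EFin \o p) -> vmeas (EFin \o q) ->
  (forall v, 0 <= p v)%R -> (forall v, 0 < q v)%R ->
  lint (EFin \o p) = 1 -> lint (EFin \o q) = 1 ->
  let phi v := (p v * expR (eta * ln (p v)) * expR (- (eta * ln (q v))))%R in
  dom 1 (lint (EFin \o phi)) /\
  (lint (EFin \o phi) = 1 -> lae (fun v => p v = q v)).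
Proof.
move=> mp mq p0 q0 lp lq phi.
have phi0 v : (0 <= phi v)%R by rewrite !mulr_ge0 ?expR_ge0.
have mphi : vmeas (EFin \o phi) by exact: vmeas_young.
have mZ k (f : 'cV[R]_n -> R) : vmeas (EFin \o f) -> vmeas (fun v => k%:E * (f v)%:E).
  by move=> mf; apply: emeasurable_funM => //; exact: measurable_cst.
have p0' v : 0 <= (p v)%:E by rewrite lee_fin.
have q0' v : 0 <= (q v)%:E by rewrite lee_fin ltW.
have phi0' v : 0 <= (phi v)%:E by rewrite lee_fin.
have eta1' : (0 <= 1 + eta)%R by rewrite -lerBlDl sub0r ltW.
have := eta0; rewrite neq_lt => /orP[e|e].
- have eN : (0 <= - eta)%R by rewrite oppr_ge0 ltW.
  pose rhs v := (1 + eta)%:E * (p v)%:E + (- eta)%:E * (q v)%:E.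
  have mrhs : vmeas rhs by apply: emeasurable_funD; exact: mZ.
  have rhsE : lint rhs = 1.
    rewrite lintD ?lintZ//; [|exact: mZ|exact: mZ| |] => [|v|v].
    + by rewrite [lint _]lp [lint _]lq !mule1 -EFinD addrK.
    + by rewrite mule_ge0// lee_fin.
    + by rewrite mule_ge0// lee_fin.
  have le v : (phi v)%:E <= rhs v.
    rewrite /rhs -!EFinM -EFinD lee_fin.
    exact: (young_neg eta1 e (p0 v) (q0 v)).1.
  split.
    split=> [e'|_]; last by rewrite -rhsE; exact: le_lint.
    by have := lt_trans e e'; rewrite ltxx.
  move=> phi1; have phiE : lint (EFin \o phi) = lint rhs by rewrite phi1.
  have := lint_eq_lae mphi mrhs phi0' le phiE; rewrite phi1 => /(_ (ltry _)).
  apply: laeW => v /eqP; rewrite /rhs -!EFinM -EFinD eqe.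
  by rewrite (young_neg eta1 e (p0 v) (q0 v)).2 => /eqP.
- have eN : (0 <= eta)%R by exact: ltW.
  (* The term in [eta] stands beside [phi] so that both sides are nonnegative; its integral is
     finite and cancels even if that of [phi] is infinite. *)
  pose rhs v := (phi v)%:E + eta%:E * (q v)%:E.
  have mrhs : vmeas rhs by apply: emeasurable_funD => //; exact: mZ.
  have rhsE : lint rhs = lint (EFin \o phi) + eta%:E.
    rewrite lintD ?lintZ//; [|exact: mZ|] => [|v].
    + by rewrite [X in _ * X]lq mule1.
    + by rewrite mule_ge0// lee_fin.
  have lhsE : lint (fun v => (1 + eta)%:E * (p v)%:E) = 1 + eta%:E.
    by rewrite lintZ// [X in _ * X]lp mule1 EFinD.
  have lhs0 v : 0 <= (1 + eta)%:E * (p v)%:E by rewrite mule_ge0// lee_fin.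
  have le v : (1 + eta)%:E * (p v)%:E <= rhs v.
    rewrite /rhs -!EFinM -EFinD lee_fin.
    exact: (young_pos e (p0 v) (q0 v)).1.
  split.
    split=> [_|e']; last by have := lt_trans e e'; rewrite ltxx.
    rewrite -(@leeD2rE _ eta%:E)// -lhsE -rhsE.
    by apply: le_lint => //; exact: mZ.
  move=> phi1; have phiE : lint (fun v => (1 + eta)%:E * (p v)%:E) = lint rhs.
    by rewrite lhsE rhsE phi1.
  have := lint_eq_lae (mZ _ _ mp) mrhs lhs0 le phiE.
  rewrite lhsE -EFinD => /(_ (ltry _)).
  apply: laeW => v /eqP; rewrite /rhs -!EFinM -EFinD eqe.
  by rewrite (young_pos e (p0 v) (q0 v)).2 => /eqP.
Qed.

End dom.

(** * One Bellman step *)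

Lemma mule_fin_inj {R : realType} (k : R) (a b : \bar R) : 0 < k ->
  (k%:E * a = k%:E * b -> a = b)%E.
Proof.
move=> k0 /(congr1 (mule (k^-1)%:E)).
by rewrite !muleA -EFinM mulVf ?gt_eqF// !mul1e.
Qed.

Section bellman_step.
Context {R : realType} {nx nu : nat}.
Variables (eta : R) (A : 'M[R]_nx) (B : 'M[R]_(nx, nu)) (Sig Q : 'M[R]_nx).
Variables (Rc : 'M[R]_nu).
Local Open Scope ereal_scope.

(** Convertible to [rs_step] at a fixed time, with that time's matrices as parameters. *)
Definition bellman (p : 'cV[R]_nx -> 'cV[R]_nu -> R) (V : 'cV[R]_nx -> \bar R)
    (x : 'cV[R]_nx) : \bar R :=
  lint (fun u : 'cV[R]_nu =>
    (p x u)%:E * (expR (eta * (qf Q x + qf Rc u + ln (p x u))))%:E *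
    lint (fun x' => (gauss_pdf (A *m x + B *m u) Sig x')%:E * V x')).

Definition policy (p : 'cV[R]_nx -> 'cV[R]_nu -> R) :=
  [/\ forall x u, (0 <= p x u)%R,
      forall x, lint (fun u => (p x u)%:E) = 1 &
      measurable_fun setT
        (fun z : Rvec R (nx + nu) => p (usubmx z) (dsubmx z))].

Hypothesis pSig : posdef Sig.

Lemma gauss_ge0 (m x : 'cV[R]_nx) : 0 <= (gauss_pdf m Sig x)%:E.
Proof. by rewrite lee_fin ltW// gauss_pdf_gt0. Qed.

Lemma gauss_lint_ge0 (m : 'cV[R]_nx) (V : 'cV[R]_nx -> \bar R) :
  (forall x, 0 <= V x) -> 0 <= lint (fun x' => (gauss_pdf m Sig x')%:E * V x').
Proof.
move=> V0; apply: lint_ge0 => x'; rewrite mule_ge0// lee_fin ltW//.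
exact: gauss_pdf_gt0.
Qed.

Lemma measurable_gauss_lint {d : measure_display} {Z : measurableType d}
    (f : Z -> 'cV[R]_nx) (V : 'cV[R]_nx -> \bar R) :
  mxmeas f -> vmeas V -> (forall x, 0 <= V x) ->
  measurable_fun setT
    (fun z => lint (fun x' => (gauss_pdf (f z) Sig x')%:E * V x')).
Proof.
move=> mf mV V0.
apply: (@measurable_lint _ nx _ _ (fun w : Z * Rvec R nx =>
  (gauss_pdf (f w.1) Sig w.2)%:E * V w.2)) => [|w]; last first.
  by rewrite mule_ge0// lee_fin ltW// gauss_pdf_gt0.
apply: emeasurable_funM; last exact: (measurableT_comp mV).
apply/measurable_EFinP; apply: measurable_gauss_pdf.
  by move=> i j; exact: (measurableT_comp (mf i j)).
by apply/mxmeas_vec; exact: measurable_snd.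
Qed.

Lemma vmeas_gauss (m : 'cV[R]_nx) (V : 'cV[R]_nx -> \bar R) :
  vmeas V -> vmeas (fun x' => (gauss_pdf m Sig x')%:E * V x').
Proof.
move=> mV; apply: emeasurable_funM => //; apply/measurable_EFinP.
by apply: measurable_gauss_pdf; [exact: mxmeas_cst|exact/mxmeas_vec].
Qed.

Lemma policy_measurable p : policy p ->
  measurable_fun setT (fun w : Rvec R nx * Rvec R nu => p w.1 w.2).
Proof.
move=> [_ _ mp].
have mc : measurable_fun setT
    (fun w : Rvec R nx * Rvec R nu => col_mx w.1 w.2 : Rvec R (nx + nu)).
  apply/mxmeas_vec; apply: mxmeas_col; apply/mxmeas_vec.
    exact: measurable_fst.
  exact: measurable_snd.
have := measurableT_comp mp mc; apply: eq_measurable_fun => w _ /=.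
by rewrite col_mxKu col_mxKd.
Qed.

Lemma measurable_bellman_integrand p V : policy p -> vmeas V ->
  (forall x, 0 <= V x) ->
  measurable_fun setT (fun w : Rvec R nx * Rvec R nu =>
    (p w.1 w.2)%:E * (expR (eta * (qf Q w.1 + qf Rc w.2 + ln (p w.1 w.2))))%:E *
    lint (fun x' => (gauss_pdf (A *m (w.1 : 'cV_nx) + B *m (w.2 : 'cV_nu))
                       Sig x')%:E * V x')).
Proof.
move=> pp mV V0; have mp := policy_measurable pp.
have m1 : mxmeas (fun w : Rvec R nx * Rvec R nu => w.1 : 'cV_nx).
  by apply/mxmeas_vec; exact: measurable_fst.
have m2 : mxmeas (fun w : Rvec R nx * Rvec R nu => w.2 : 'cV_nu).
  by apply/mxmeas_vec; exact: measurable_snd.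
apply: emeasurable_funM.
  rewrite [X in measurable_fun _ X](_ : _ = EFin \o (fun w => (p w.1 w.2 *
    expR (eta * (qf Q w.1 + qf Rc w.2 + ln (p w.1 w.2))))%R))//.
  apply/measurable_EFinP; apply: measurable_funM => //.
  apply: measurableT_comp => //; apply: measurable_funM => //.
  apply: measurable_funD; first by apply: measurable_funD; exact: measurable_qf.
  exact: measurableT_comp.
apply: measurable_gauss_lint => //.
by apply: mxmeasD; apply: mxmeasM => //; exact: mxmeas_cst.
Qed.

Lemma bellman_integrand_ge0 p V x u : policy p -> (forall x, 0 <= V x) ->
  0 <= (p x u)%:E * (expR (eta * (qf Q x + qf Rc u + ln (p x u))))%:E *
    lint (fun x' => (gauss_pdf (A *m x + B *m u) Sig x')%:E * V x').
Proof.
move=> [p0 _ _] V0; rewrite mule_ge0// ?gauss_lint_ge0//.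
by rewrite -EFinM lee_fin mulr_ge0 ?expR_ge0.
Qed.

Lemma bellman_ge0 p V x : policy p -> (forall x, 0 <= V x) ->
  0 <= bellman p V x.
Proof. by move=> pp V0; apply: lint_ge0 => u; exact: bellman_integrand_ge0. Qed.

Lemma vmeas_bellman p V : policy p -> vmeas V -> (forall x, 0 <= V x) ->
  vmeas (bellman p V).
Proof.
move=> pp mV V0; apply: (measurable_lint (measurable_bellman_integrand pp mV V0)).
by move=> w; exact: bellman_integrand_ge0.
Qed.

Variables (Pi0 Pi1 : 'M[R]_nx).
Hypothesis (eta1 : (-1 < eta)%R) (eta0 : eta != 0%R).
Hypothesis (pRc : posdef Rc) (pPi1 : posdef Pi1).

Let W := Pi1 *m invmx (1%:M - eta *: (Sig *m Pi1)).
Let M := (Rc + B^T *m W *m B)%R.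
Let Y := (1%:M - eta *: (Sig *m Pi1) + B *m invmx Rc *m B^T *m Pi1)%R.

Hypothesis (pP : posdef (invmx Sig - eta *: Pi1)).
Hypothesis (uY : Y \in unitmx).
Hypothesis Pi0E : Pi0 = (Q + A^T *m Pi1 *m invmx Y *m A)%R.

Let pstar x u := gauss_pdf (- (invmx M *m B^T *m W *m A *m x)) (invmx M) u.
Let vstar (P : 'M[R]_nx) c x := (expR (eta * (qf P x + c)))%:E.

Lemma pstar_gt0 x u : (0 < pstar x u)%R.
Proof. by apply: gauss_pdf_gt0; apply: posdef_inv; exact: posdef_M. Qed.

Lemma policy_pstar : policy pstar.
Proof.
split.
- by move=> x u; exact/ltW/pstar_gt0.
- by move=> x; apply: lint_gauss_pdf; apply: posdef_inv; exact: posdef_M.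
- apply: measurable_gauss_pdf.
    apply: mxmeasN; apply: mxmeasM; first exact: mxmeas_cst.
    by apply: mxmeas_usub; exact/mxmeas_vec.
  by apply: mxmeas_dsub; exact/mxmeas_vec.
Qed.

Lemma vmeas_vstar P c : vmeas (vstar P c).
Proof.
apply/measurable_EFinP; apply: measurableT_comp => //.
apply: measurable_funM => //; apply: measurable_funD => //.
by apply: measurable_qf; exact/mxmeas_vec.
Qed.

(** The gap splits in two: [vstar Pi0] against [bellman p (vstar Pi1)], by [lint_young], and the
    latter against [bellman p V], by monotonicity. The constant [c0] is fixed before [p] and [V]. *)
Lemma bellman_optimal c : exists c0 : R,
  bellman pstar (vstar Pi1 c) =1 vstar Pi0 c0 /\
  forall p V, policy p -> vmeas V -> (forall x, 0 <= V x) ->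
    (forall x, dom eta (vstar Pi1 c x) (V x)) ->
    forall x, dom eta (vstar Pi0 c0 x) (bellman p V x) /\
      (bellman p V x = vstar Pi0 c0 x ->
        lae (fun u => p x u = pstar x u) /\ lae (fun x' => V x' = vstar Pi1 c x')).
Proof.
have [c0 [G GE GS]] := optimal_step eta0 pSig pRc pPi1 pP uY Pi0E c.
exists c0.
have vs0 P c' x : 0 <= vstar P c' x by rewrite lee_fin expR_ge0.
pose phi (p : 'cV[R]_nx -> 'cV[R]_nu -> R) x u :=
  (p x u * expR (eta * ln (p x u)) * expR (- (eta * ln (pstar x u))))%R.
(* All dependence on the policy is gathered in [phi], that is [p^(1 + eta) pstar^(- eta)]. *)
have integrandE p x u : (p x u)%:E *
    (expR (eta * (qf Q x + qf Rc u + ln (p x u))))%:E *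
    lint (fun x' => (gauss_pdf (A *m x + B *m u) Sig x')%:E * vstar Pi1 c x') =
    vstar Pi0 c0 x * (phi p x u)%:E.
  rewrite (GE x u) /vstar -!EFinM /phi; congr EFin.
  rewrite mulrDr expRD; have := GS x u.
  move: (expR (eta * (qf Q x + qf Rc u))) (G x u) (expR (eta * (qf Pi0 x + c0))).
  move: (expR (- _)) (p x u) => d r a g b h; move: (expR (eta * ln r)) => e.
  transitivity (r * e * (a * g))%R; first by ring.
  by rewrite h; ring.
have msec p x : policy p -> vmeas (EFin \o p x).
  move=> /policy_measurable mp; apply/measurable_EFinP.
  exact: (measurable_fun_pair2 (x : Rvec R nx) mp).
have bellmanE p x : policy p ->
    bellman p (vstar Pi1 c) x = vstar Pi0 c0 x * lint (EFin \o phi p x).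
  move=> pp; rewrite -lintZ ?expR_ge0//.
  - exact: eq_lint.
  - by apply: vmeas_young; apply: msec => //; exact: policy_pstar.
  - by case: pp => p0 _ _ u; rewrite lee_fin !mulr_ge0 ?expR_ge0.
split=> [x|p V pp mV V0 dV x].
  rewrite bellmanE; last exact: policy_pstar.
  rewrite (_ : lint _ = 1) ?mule1//; have [_ /(_ x) <- _] := policy_pstar.
  by apply: eq_lint => u; rewrite /= /phi -mulrA -expRD subrr expR0 mulr1.
have [p0 lp _] := pp; have [_ lps _] := policy_pstar.
have [dphi phi1] := lint_young eta0 eta1 (msec p x pp) (msec _ x policy_pstar)
  (p0 x) (pstar_gt0 x) (lp x) (lps x).
have d1 : dom eta (vstar Pi0 c0 x) (bellman p (vstar Pi1 c) x).
  by rewrite bellmanE// -[X in dom _ X _]mule1; apply: dom_mull.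
have dG u : dom eta
    (lint (fun x' => (gauss_pdf (A *m x + B *m u) Sig x')%:E * vstar Pi1 c x'))
    (lint (fun x' => (gauss_pdf (A *m x + B *m u) Sig x')%:E * V x')).
  apply: dom_lint => [| |x'|x'|x'].
  - by apply: vmeas_gauss; exact: vmeas_vstar.
  - exact: vmeas_gauss.
  - by rewrite mule_ge0// lee_fin ltW// gauss_pdf_gt0.
  - by rewrite mule_ge0// lee_fin ltW// gauss_pdf_gt0.
  - by apply: dom_mull => //; rewrite lee_fin ltW// gauss_pdf_gt0.
have mf := measurable_fun_pair2 (x : Rvec R nx)
  (measurable_bellman_integrand pp (vmeas_vstar Pi1 c) (vs0 Pi1 c)).
have mg := measurable_fun_pair2 (x : Rvec R nx)
  (measurable_bellman_integrand pp mV V0).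
have k0 u : 0 <= (p x u)%:E * (expR (eta * (qf Q x + qf Rc u + ln (p x u))))%:E.
  by rewrite -EFinM lee_fin mulr_ge0 ?expR_ge0.
have dint u := dom_mull (k0 u) (dG u).
have f0 u := bellman_integrand_ge0 x u pp (vs0 Pi1 c).
have g0 u := bellman_integrand_ge0 x u pp V0.
have d2 : dom eta (bellman p (vstar Pi1 c) x) (bellman p V x).
  by apply: dom_lint mf mg f0 g0 _ => u; exact: dint.
split; first exact: dom_trans d1 d2.
(* Equality of the two ends collapses the chain, so both comparisons are equalities. *)
move=> VE; have midE := dom_squeeze eta0 d1 d2 (esym VE).
have lphi : lint (EFin \o phi p x) = 1.
  apply: (@mule_fin_inj _ (expR (eta * (qf Pi0 x + c0)))); first exact: expR_gt0.
  by rewrite mule1 -bellmanE.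
have pE := phi1 lphi; split=> //.
have midV : bellman p (vstar Pi1 c) x = bellman p V x by rewrite midE VE.
have midoo : bellman p (vstar Pi1 c) x < +oo by rewrite midE ltry.
have gfE := dom_lint_eq eta0 mf mg f0 g0 dint midV midoo.
(* One [u] with [p = pstar] and equal integrands is enough: the density is positive there, so it can
   be cancelled, leaving equal Gaussian integrals of [V] and [vstar Pi1]. *)
have [u [pu]] := lae_ex (laeI pE gfE); rewrite -!EFinM => gfu.
have pu0 : (0 < p x u * expR (eta * (qf Q x + qf Rc u + ln (p x u))))%R.
  by rewrite mulr_gt0 ?expR_gt0// pu pstar_gt0.
have GV := mule_fin_inj pu0 gfu.
have Gfin : lint (fun x' => (gauss_pdf (A *m x + B *m u) Sig x')%:E * vstar Pi1 c x')
    < +oo by rewrite (GE x u) ltry.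
have := dom_lint_eq eta0 (vmeas_gauss _ (vmeas_vstar Pi1 c)) (vmeas_gauss _ mV)
  _ _ _ (esym GV) Gfin.
have gv0 W' : (forall x', 0 <= W' x') ->
    forall x', 0 <= (gauss_pdf (A *m x + B *m u) Sig x')%:E * W' x'.
  by move=> W0 x'; rewrite mule_ge0// lee_fin ltW// gauss_pdf_gt0.
move=> /(_ (gv0 _ (vs0 Pi1 c)) (gv0 _ V0)) h.
have {}h := h (fun x' => dom_mull (gauss_ge0 _ _) (dV x')).
apply: laeW h => x' /mule_fin_inj; apply.
exact: gauss_pdf_gt0.
Qed.

End bellman_step.

(** * Backward induction *)

(** The integral of this indicator measures the set where two policies disagree. *)
Lemma measurable_neq {R : realType} {d : measure_display} {Z : measurableType d}
    (f g : Z -> R) : measurable_fun setT f -> measurable_fun setT g ->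
  measurable_fun setT (fun z => ((f z != g z)%:R : R)%:E).
Proof.
move=> mf mg; apply/measurable_EFinP.
rewrite (_ : (fun _ => _) = (fun z => if f z == g z then 0 else 1 : R)).
  by apply: measurable_fun_ifT => //; exact: measurable_fun_eqr.
by apply/funext => z; case: eqP.
Qed.

(** Null sets refer to [mu0] times Lebesgue measure at time 0, where the law of the state is
    arbitrary, and to Lebesgue measure afterwards, where the Gaussian transitions give the state a
    positive density. *)
Theorem theorem4 (R : realType) (nx nu T : nat) (eta : R)
    (A : nat -> 'M[R]_nx) (B : nat -> 'M[R]_(nx, nu)) (Sig : nat -> 'M[R]_nx)
    (Q : nat -> 'M[R]_nx) (Rc : nat -> 'M[R]_nu)
    (mu0 : probability (Rvec R nx) R) (Pi : nat -> 'M[R]_nx) :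
  (0 < T)%N -> -1 < eta -> eta != 0 ->
  (forall t, (t < T)%N -> posdef (Sig t)) ->
  (forall t, (t <= T)%N -> posdef (Q t)) ->
  (forall t, (t < T)%N -> posdef (Rc t)) ->
  (* {Pi_t} solves the Riccati difference equation *)
  Pi T = Q T ->
  (forall t, (t < T)%N ->
     1%:M - eta *: (Sig t *m Pi t.+1) + B t *m invmx (Rc t) *m (B t)^T *m Pi t.+1
       \in unitmx /\
     Pi t = Q t + (A t)^T *m Pi t.+1 *m
              invmx (1%:M - eta *: (Sig t *m Pi t.+1)
                     + B t *m invmx (Rc t) *m (B t)^T *m Pi t.+1) *m A t) ->
  (forall t, (t < T)%N -> posdef (invmx (Sig t) - eta *: Pi t.+1)) ->
  let W t := Pi t.+1 *m invmx (1%:M - eta *: (Sig t *m Pi t.+1)) in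
  let M t := Rc t + (B t)^T *m W t *m B t in
  let pstar : nat -> 'cV[R]_nx -> 'cV[R]_nu -> R := fun t x u =>
      gauss_pdf (- (invmx (M t) *m (B t)^T *m W t *m A t *m x)) (invmx (M t)) u in
  let J := rs_objective T eta A B Sig Q Rc mu0 in
  [/\ admissible T pstar,
      (* optimality *)
      (forall pol, admissible T pol -> (J pstar <= J pol)%E) &
      (* uniqueness (up to null sets), whenever the optimal value is finite *)
      (forall pol, admissible T pol -> J pol = J pstar -> J pstar \is a fin_num ->
         (\int[mu0]_(x in setT)
             lint (fun u => ((pol 0%N x u != pstar 0%N x u)%:R : R)%:E) = 0)%E /\
         (forall t, (0 < t < T)%N ->
            lint (fun z : 'cV[R]_(nx + nu) =>
              ((pol t (usubmx z) (dsubmx z) != pstar t (usubmx z) (dsubmx z))%:R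
                 : R)%:E) = 0%E))].
Proof.
move=> T0 eta1 eta0 pS pQ pR PiT Pirec pP W M pstar J.
(* Positive definiteness propagates backwards from [Pi T = Q T]; [k] counts the steps to the
   horizon, as in [rs_value]. *)
have pPi k : (k <= T)%N -> posdef (Pi (T - k)%N).
  elim: k => [_|k IH kT]; first by rewrite subn0 PiT; exact: pQ.
  have tT : (T - k.+1 < T)%N by rewrite ltn_subrL T0.
  have tE : (T - k.+1).+1 = (T - k)%N by rewrite subnSK.
  have pk : posdef (Pi (T - k.+1).+1) by rewrite tE; apply: IH; exact: ltnW.
  have [uY PiE] := Pirec _ tT.
  exact: posdef_riccati (pS _ tT) (pQ _ (ltnW tT)) (pR _ tT) pk (pP _ tT) uY PiE.
have pPi1 t : (t < T)%N -> posdef (Pi t.+1).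
  by move=> tT; rewrite -(subKn tT); apply: pPi; exact: leq_subr.
have polP (pol : nat -> 'cV[R]_nx -> 'cV[R]_nu -> R) t :
    admissible T pol -> (t < T)%N -> policy (pol t).
  by move=> apol /apol.
have pstarP t : (t < T)%N -> policy (pstar t).
  move=> tT; exact: (policy_pstar (A t) (B t) (pS _ tT) (pR _ tT) (pPi1 _ tT) (pP _ tT)).
have astar : admissible T pstar by move=> t tT; exact: pstarP.
pose vstar (P : 'M[R]_nx) c x := (expR (eta * (qf P x + c)))%:E.
have vstar0 P c x : (0 <= vstar P c x)%E by rewrite lee_fin expR_ge0.
(* Choice turns the existential constants of [bellman_optimal] into a function of the time and of
   the constant one step later; beyond the horizon the condition is vacuous and 0 serves. *)
have /choice[next nextP] (tc : nat * R) : exists c0 : R, (tc.1 < T)%N ->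
    bellman eta (A tc.1) (B tc.1) (Sig tc.1) (Q tc.1) (Rc tc.1) (pstar tc.1)
      (vstar (Pi tc.1.+1) tc.2) =1 vstar (Pi tc.1) c0 /\
    forall p V, policy p -> vmeas V -> (forall x, (0 <= V x)%E) ->
    (forall x, dom eta (vstar (Pi tc.1.+1) tc.2 x) (V x)) ->
    forall x, dom eta (vstar (Pi tc.1) c0 x)
        (bellman eta (A tc.1) (B tc.1) (Sig tc.1) (Q tc.1) (Rc tc.1) p V x) /\
      (bellman eta (A tc.1) (B tc.1) (Sig tc.1) (Q tc.1) (Rc tc.1) p V x =
         vstar (Pi tc.1) c0 x ->
        lae (fun u => p x u = pstar tc.1 x u) /\
        lae (fun x' => V x' = vstar (Pi tc.1.+1) tc.2 x')).
  case: tc => t c /=; have [tT|tT] := ltnP t T; last by exists 0.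
  have [uY PiE] := Pirec _ tT.
  have [c0 cP] := bellman_optimal (pS _ tT) eta1 eta0 (pR _ tT) (pPi1 _ tT)
    (pP _ tT) uY PiE c.
  by exists c0.
(* [cc k] is the additive constant at time [T - k]; the terminal cost has none. *)
pose fix cc k : R := if k is k'.+1 then next ((T - k'.+1)%N, cc k') else 0.
pose star k := vstar (Pi (T - k)%N) (cc k).
have tS k : (k < T)%N -> (T - k.+1 < T)%N /\ (T - k.+1).+1 = (T - k)%N.
  by move=> kT; rewrite ltn_subrL T0 subnSK.
pose value := rs_value T eta A B Sig Q Rc.
have valueS pol k : value pol k.+1 =
    bellman eta (A (T - k.+1)%N) (B (T - k.+1)%N) (Sig (T - k.+1)%N)
      (Q (T - k.+1)%N) (Rc (T - k.+1)%N) (pol (T - k.+1)%N) (value pol k) by [].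
have value0 pol : value pol 0%N = star 0%N.
  by apply/funext => x; rewrite /star /vstar subn0 PiT addr0.
have starE k : (k <= T)%N -> value pstar k = star k.
  elim: k => [_|k IH kT]; first exact: value0.
  have [tT tE] := tS _ kT; have [sE _] := nextP ((T - k.+1)%N, cc k) tT.
  apply/funext => x; rewrite valueS IH ?(ltnW kT)//.
  by have := sE x; rewrite /= tE.
have valueP pol k : admissible T pol -> (k <= T)%N ->
    [/\ vmeas (value pol k), forall x, (0 <= value pol k x)%E &
        forall x, dom eta (star k x) (value pol k x)].
  move=> apol; elim: k => [_|k IH kT].
    rewrite value0; split=> [|x|x]; [exact: vmeas_vstar|exact: vstar0|exact: dom_refl].
  have [tT tE] := tS _ kT; have [mV V0 dV] := IH (ltnW kT).
  have pp := polP pol _ apol tT.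
  rewrite valueS; split.
  - by apply: vmeas_bellman => //; exact: pS.
  - by move=> x; apply: bellman_ge0 => //; exact: pS.
  - have [_ sP] := nextP ((T - k.+1)%N, cc k) tT.
    move=> x; apply: (sP (pol (T - k.+1)%N) (value pol k) _ _ _ _ x).1 => //=.
    by rewrite tE.
have valueU pol k x : admissible T pol -> (k < T)%N ->
    value pol k.+1 x = star k.+1 x ->
    lae (fun u => pol (T - k.+1)%N x u = pstar (T - k.+1)%N x u) /\
    lae (fun x' => value pol k x' = star k x').
  move=> apol kT; have [tT tE] := tS _ kT; have [mV V0 dV] := valueP pol _ apol (ltnW kT).
  have pp := polP pol _ apol tT.
  have [_ sP] := nextP ((T - k.+1)%N, cc k) tT.
  have := (sP (pol (T - k.+1)%N) (value pol k) pp mV V0 _ x).2.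
  by rewrite /= tE; apply.
pose I pol := (\int[mu0]_(x in setT) value pol T x)%E.
have JE pol : J pol = ((eta^-1)%:E * lne (I pol))%E by [].
have I0 pol : admissible T pol -> (0 <= I pol)%E.
  move=> apol; have [_ V0 _] := valueP pol T apol (leqnn _).
  by apply: integral_ge0 => x _.
have Iitv pol : admissible T pol -> I pol \in `[0%E, +oo%E].
  by move=> apol; rewrite in_itv /= I0// leey.
have starT := starE T (leqnn _).
have mstar : vmeas (star T) by exact: vmeas_vstar.
split=> //.
- move=> pol apol; rewrite !JE; have [mV V0 dV] := valueP pol T apol (leqnn _).
  (* A negative [eta^-1] reverses the order, and so does [dom]; in both cases [lne] is monotone on
     [[0, +oo]]. *)
  have := eta0; rewrite neq_lt => /orP[e|e].
    rewrite leNgt lte_nmul2l ?lte_fin ?invr_lt0// -leNgt lee_lne ?Iitv// /I starT.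
    by apply: ge0_le_integral => // x _; exact: (dV x).2.
  rewrite lee_pmul2l ?lte_fin ?invr_gt0// lee_lne ?Iitv// /I starT.
  by apply: ge0_le_integral => // x _; [exact: vstar0|exact: (dV x).1].
- move=> pol apol Jeq Jfin; have [mV V0 dV] := valueP pol T apol (leqnn _).
  have lneE : lne (I pol) = lne (I pstar).
    have : (eta%:E * J pol = eta%:E * J pstar)%E by rewrite Jeq.
    by rewrite !JE !muleA -EFinM mulfV// !mul1e.
  have IE : I pol = I pstar by apply: lne_inj lneE; exact: Iitv.
  (* A finite objective excludes an infinite integral, as needed to pass from equal integrals to
     equality almost everywhere. *)
  have Ioo : (I pstar < +oo)%E.
    rewrite ltey; apply/eqP => Iy; move: Jfin; rewrite JE Iy /=.
    have := eta0; rewrite neq_lt => /orP[e|e].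
      by rewrite lt0_muley ?lte_fin ?invr_lt0.
    by rewrite gt0_muley ?lte_fin ?invr_gt0.
  have aeV : \forall x \ae mu0, value pol T x = star T x.
    have := eta0; rewrite neq_lt => /orP[e|e].
      have := @integral_eq_ae _ _ _ mu0 _ _ mV mstar V0 (fun x => (dV x).2 e).
      rewrite -/(I pol) -starT IE => /(_ erefl Ioo).
      by apply: filterS => x [].
    have := @integral_eq_ae _ _ _ mu0 _ _ mstar mV (vstar0 _ _) (fun x => (dV x).1 e).
    rewrite -/(I pol) -starT IE => /(_ erefl Ioo).
    by apply: filterS => x [].
  have TS : T.-1.+1 = T by exact: prednK.
  have mu0T : (0 < mu0 setT)%E by rewrite probability_setT.
  have PT := ae_properfilter_algebraOfSetsType mu0T.
  (* Forward in time means decreasing [k]: the descent starts from one initial state given by [aeV]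
     and takes one new point from [lae_ex] at each step. Writing [k] as [T.-1 - j] makes it an
     induction on [j]. *)
  have laeV k : (k < T)%N -> lae (fun x => value pol k x = star k x).
    move=> kT; rewrite -(subKn (_ : k <= T.-1)%N); last by rewrite -ltnS TS.
    have : (T.-1 - k <= T.-1)%N by exact: leq_subr.
    elim: (T.-1 - k)%N => [_|j IH jT].
      rewrite subn0; have [x xE] := filter_ex aeV.
      by apply: (valueU pol T.-1 x apol _ _).2; rewrite TS.
    have jE : (T.-1 - j.+1).+1 = (T.-1 - j)%N by rewrite subnSK.
    have [x xE] := lae_ex (IH (ltnW jT)).
    apply: (valueU pol _ x apol _ _).2; rewrite jE//.
    by rewrite (leq_trans (leq_subr _ _))// leq_pred.
  split.
    (* At time 0 the value functions agree for [mu0]-almost every initial state, and [valueU] is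
       applied at each of these. *)
    transitivity (\int[mu0]_(x in setT) (cst 0%E x))%E; last exact: integral0.
    have mneq : measurable_fun setT (fun w : Rvec R nx * Rvec R nu =>
        ((pol 0%N w.1 w.2 != pstar 0%N w.1 w.2)%:R : R)%:E).
      by apply: measurable_neq; apply: policy_measurable; [exact: apol|exact: pstarP].
    apply: ge0_ae_eq_integral => //.
    - by apply: (measurable_lint mneq) => w; rewrite lee_fin.
    - by move=> x _; apply: lint_ge0 => u; rewrite lee_fin.
    move: aeV; apply: filterS => x xE _.
    apply: lint_lae0 => [|u|].
    - exact: (measurable_fun_pair2 (x : Rvec R nx) mneq).
    - by rewrite lee_fin.
    have kT : (T.-1 < T)%N by rewrite TS.
    have [|h _] := valueU pol T.-1 x apol kT; first by rewrite TS.
    by move: h; rewrite TS subnn; apply: laeW => u ->; rewrite eqxx.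
  move=> t /andP[t0 tT].
  have mneq : measurable_fun setT (fun w : Rvec R nx * Rvec R nu =>
      ((pol t w.1 w.2 != pstar t w.1 w.2)%:R : R)%:E).
    by apply: measurable_neq; apply: policy_measurable; [exact: apol|exact: pstarP].
  rewrite lint_add; apply: lint_lae0 => [|x|].
  - under eq_fun do under eq_lint do rewrite col_mxKu col_mxKd.
    by apply: (measurable_lint mneq) => w; rewrite lee_fin.
  - by apply: lint_ge0 => u; rewrite lee_fin.
  have kS : (T - t.+1).+1 = (T - t)%N by rewrite subnSK.
  (* Since [t > 0], the index [T - t] is below [T], where agreement holds Lebesgue-almost
     everywhere. *)
  apply: laeW (laeV (T - t)%N _); last by rewrite ltn_subrL t0.
  rewrite -kS => x xE; apply: lint_lae0 => [|u|].
  - under eq_fun do rewrite col_mxKu col_mxKd.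
    exact: (measurable_fun_pair2 (x : Rvec R nx) mneq).
  - by rewrite lee_fin.
  have kT : (T - t.+1 < T)%N by rewrite kS leq_subr.
  have [h _] := valueU pol (T - t.+1)%N x apol kT xE.
  move: h; rewrite kS (subKn (ltnW tT)); apply: laeW => u uE.
  by rewrite col_mxKu col_mxKd uE eqxx.
Qed.
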